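(* Let $\mathbb{K}$ be a field, let $R$ be a finitely presented Koszul $\mathbb{K}$-algebra, and let $A=\sigma(R)\langle x_1,\dots,x_n\rangle$ be a graded skew PBW extension of $R$. Then $A$ is Koszul.
   Context: $\mathbb{K}$ is a field, $\mathbb{N}=\{0,1,2,\dots\}$, and all algebras are $\mathbb{K}$-algebras. Skew PBW extension: let $R\subseteq A$ be rings. $A$ is a skew PBW extension of $R$, written $A=\sigma(R)\langle x_1,\dots,x_n\rangle$, if there are finitely many elements $x_1,\dots,x_n\in A$ such that: (a) $A$ is a free left $R$-module with basis $\mathrm{Mon}(A)=\{x^\alpha=x_1^{\alpha_1}\cdots x_n^{\alpha_n}\mid \alpha\in\mathbb{N}^n\}$; (b) for each $1\le i\le n$ and $r\in R\setminus\{0\}$ there is $c_{i,r}\in R\setminus\{0\}$ with $x_ir-c_{i,r}x_i\in R$; (c) for all $1\le i,j\le n$ there is $c_{i,j}\in R\setminus\{0\}$ with $x_jx_i-c_{i,j}x_ix_j\in R+Rx_1+\cdots+Rx_n$. In this case, for each $i$ there are an injective ring endomorphism $\sigma_i:R\to R$ and a $\sigma_i$-derivation $\delta_i:R\to R$ (additive, $\delta_i(rs)=\sigma_i(r)\delta_i(s)+\delta_i(r)s$) with $x_ir=\sigma_i(r)x_i+\delta_i(r)$ for all $r\in R$. $A$ is called bijective if every $\sigma_i$ is bijective and $c_{i,j}$ is invertible for all $1\le i<j\le n$. Graded skew PBW extension: a bijective skew PBW extension $A=\sigma(R)\langle x_1,\dots,x_n\rangle$ of an $\mathbb{N}$-graded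 $\mathbb{K}$-algebra $R=\bigoplus_{p\ge0}R_p$ (with $A$ a $\mathbb{K}$-algebra containing $R$ as a subalgebra) such that: (i) $x_1,\dots,x_n$ have degree $1$ in $A$; (ii) each $\sigma_i$ is a graded ring homomorphism ($\sigma_i(R_p)\subseteq R_p$) and each $\delta_i$ is a graded $\sigma_i$-derivation $R(-1)\to R$ (i.e. $\delta_i(R_p)\subseteq R_{p+1}$); (iii) $x_jx_i-c_{i,j}x_ix_j\in R_2+R_1x_1+\cdots+R_1x_n$ with $c_{i,j}\in R_0$ for all $i,j$. $A$ is graded by $A=\bigoplus_{p\ge0}A_p$, where $A_p$ is the $\mathbb{K}$-span of $\{r x^\alpha\mid r\in R_t,\ x^\alpha\in\mathrm{Mon}(A),\ t+|\alpha|=p\}$ and $|\alpha|=\alpha_1+\cdots+\alpha_n$. Finitely presented: a finitely graded algebra $B$ ($\mathbb{N}$-graded, connected i.e. $B_0=\mathbb{K}$, and finitely generated as a $\mathbb{K}$-algebra) is finitely presented if $B\cong\mathbb{K}\langle t_1,\dots,t_m\rangle/I$ as graded algebras (the generators $t_k$ having the positive degrees of the corresponding homogeneous generators of $B$) with $I$ a homogeneous two-sided ideal that is finitely generated as a two-sided ideal. Koszul: a locally finite graded algebra $B=\mathbb{K}\oplus B_1\oplus B_2\oplus\cdots$ (all $\dim_{\mathbb{K}}B_j<\infty$) is Koszul if the trivial module $\mathbb{K}$ admits a linear free resolution, i.e. a resolution $\cdots\to P_2\to P_1\to P_0\to\mathbb{K}\to0$ by graded free $B$-modules and degree-preserving maps,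 with $P_i$ generated in degree $i$. Equivalently, $\mathrm{Ext}_B^{s,p}(\mathbb{K},\mathbb{K})=0$ for $s\ne p$, where $s$ is the cohomological degree and $-p$ the internal degree. *)

(* Defs.v *)
From HB Require Import structures.
From mathcomp Require Import all_boot all_order all_algebra.
From mathcomp Require Import finmap monalg.

Set Implicit Arguments.
Unset Strict Implicit.
Unset Printing Implicit Defensive.

Import GRing.Theory.
Local Open Scope ring_scope.

(* Algebras are in general infinite dimensional, so subspaces are predicates
   [V -> Prop]; a grading is a family of such predicates. *)

Section Linear.

Definition in_span (S : pzRingType) (V : lmodType S) (X : V -> Prop) (v : V) :
    Prop :=
  exists s : seq (S * V),
    (forall cu, cu \in s -> X cu.2) /\ v = \sum_(cu <- s) cu.1 *: cu.2.

(* The action is an explicit argument because we use both modules in the sense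
   of the library and an algebra seen as a left module over a subalgebra. *)
Definition left_basis (S : pzRingType) (V : zmodType) (act : S -> V -> V)
    (X : eqType) (e : X -> V) : Prop :=
  (forall v : V, exists (s : seq X) (c : X -> S),
     v = \sum_(x <- s) act (c x) (e x)) /\
  (forall (s : seq X) (c : X -> S), uniq s ->
     \sum_(x <- s) act (c x) (e x) = 0 -> forall x, x \in s -> c x = 0).

Definition direct_sum (I : eqType) (V : zmodType) (g : I -> V -> Prop) : Prop :=
  [/\ forall i, g i 0,
      forall i u v, g i u -> g i v -> g i (u - v),
      forall v : V, exists (s : seq I) (c : I -> V),
        (forall i, g i (c i)) /\ v = \sum_(i <- s) c i
    & forall (s : seq I) (c : I -> V), uniq s -> (forall i, g i (c i)) ->
        \sum_(i <- s) c i = 0 -> forall i, i \in s -> c i = 0].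

End Linear.

Section GradedAlgebras.

Variables (K : fieldType) (B : algType K) (gr : nat -> B -> Prop).

Definition graded_algebra : Prop :=
  [/\ direct_sum gr,
      forall p (k : K) b, gr p b -> gr p (k *: b),
      gr 0 1
    & forall p q b b', gr p b -> gr q b' -> gr (p + q)%N (b * b')].

Definition connected : Prop := forall b, gr 0 b <-> exists k : K, b = k%:A.

Definition locally_finite : Prop :=
  forall p, exists s : seq B, forall b, gr p b <-> in_span (fun u => u \in s) b.

End GradedAlgebras.

(* K<t_1, ..., t_m>: the monoid algebra of the free monoid on 'I_m *)
Notation free_algebra K m := {malg K[{fmonom 'I_m}]}.

Section FinitePresentation.

Variable K : fieldType.

Definition word_deg m (d : 'I_m -> nat) (w : {fmonom 'I_m}) : nat :=
  (\sum_(k <- fmonom_val w) d k)%N.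

Definition free_grading m (d : 'I_m -> nat) (p : nat) (f : free_algebra K m) :
    Prop :=
  forall w, w \in msupp f -> word_deg d w = p.

Definition two_sided_ideal (F : nzRingType) (I : F -> Prop) : Prop :=
  [/\ I 0, forall f g, I f -> I g -> I (f + g)
    & forall a f b, I f -> I (a * f * b)].

Definition fg_ideal (F : nzRingType) (I : F -> Prop) : Prop :=
  exists s : seq F, forall f, I f <->
    exists u : seq (F * F * F),
      (forall z, z \in u -> z.1.2 \in s) /\
      f = \sum_(z <- u) z.1.1 * z.1.2 * z.2.

Definition homogeneous_ideal m (d : 'I_m -> nat) (I : free_algebra K m -> Prop) :
    Prop :=
  forall f, I f -> exists (s : seq nat) (c : nat -> free_algebra K m),
    (forall p, free_grading d p (c p) /\ I (c p)) /\ f = \sum_(p <- s) c p.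

Variables (B : algType K) (gr : nat -> B -> Prop).

Definition finitely_generated : Prop :=
  exists m (pi : {lrmorphism free_algebra K m -> B}),
    forall b, exists f, pi f = b.

Definition finitely_graded : Prop :=
  [/\ graded_algebra gr, connected gr & finitely_generated].

(* B is isomorphic to K<t>/I as a graded algebra: there is an algebra morphism
   pi with kernel I mapping the degree p part of K<t> onto B_p for all p. *)
Definition finitely_presented : Prop :=
  finitely_graded /\
  exists (m : nat) (d : 'I_m -> nat) (I : free_algebra K m -> Prop)
         (pi : {lrmorphism free_algebra K m -> B}),
    [/\ forall k, (0 < d k)%N,
        [/\ two_sided_ideal I, homogeneous_ideal d I & fg_ideal I],
        forall f, pi f = 0 <-> I f
      & forall p b, gr p b <-> exists2 f, free_grading d p f & pi f = b].

End FinitePresentation.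

Section Koszul.

Variables (K : fieldType) (B : algType K) (gr : nat -> B -> Prop).

Definition graded_module (M : lmodType B) (gM : int -> M -> Prop) : Prop :=
  direct_sum gM /\
  forall p q b v, gr p b -> gM q v -> gM (p%:Z + q) (b *: v).

Definition graded_free (M : lmodType B) (gM : int -> M -> Prop) : Prop :=
  graded_module gM /\
  exists (X : eqType) (e : X -> M) (deg : X -> int),
    (forall x, gM (deg x) (e x)) /\
    left_basis (fun (b : B) (v : M) => b *: v) e.

Definition generated_in_degree (M : lmodType B) (gM : int -> M -> Prop)
    (q : int) : Prop :=
  forall v, in_span (gM q) v.

(* The projection of B onto B_0 = K; the trivial module is K, concentrated in
   degree 0, on which b acts as multiplication by [eps b]. *)
Definition augmentation (eps : {lrmorphism B -> K^o}) : Prop :=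
  forall p b, (0 < p)%N -> gr p b -> eps b = 0.

Definition linear_free_resolution (eps : {lrmorphism B -> K^o})
    (P : nat -> lmodType B) (gP : forall i, int -> P i -> Prop)
    (d : forall i, {linear P i.+1 -> P i}) (eta : {additive P 0 -> K}) : Prop :=
  [/\ forall i, graded_free (@gP i) /\ generated_in_degree (@gP i) i%:Z,
      forall i (q : int) (v : P i.+1), gP i.+1 q v -> gP i q (d i v),
      [/\ forall b v, eta (b *: v) = eps b * eta v,
          forall (q : int) (v : P 0%N), q != 0 -> gP 0 q v -> eta v = 0
        & forall k, exists v, eta v = k],
      forall v, eta v = 0 <-> exists w, d 0 w = v
    & forall i v, d i v = 0 <-> exists w, d i.+1 w = v].

Definition koszul : Prop :=
  [/\ graded_algebra gr, connected gr, locally_finite gr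
    & exists eps : {lrmorphism B -> K^o}, augmentation eps /\
      exists P gP d eta, @linear_free_resolution eps P gP d eta].

End Koszul.

Section SkewPBW.

(* The inclusion of R in A is given as an injective morphism [iota]. *)
Variables (K : fieldType) (R A : algType K) (iota : {lrmorphism R -> A}).
Variables (n : nat) (x : 'I_n -> A).

Definition smon (alpha : {ffun 'I_n -> nat}) : A :=
  \prod_(i < n) x i ^+ alpha i.

Definition in_affine_span (S0 S1 : R -> Prop) (a : A) : Prop :=
  exists (r0 : R) (r : 'I_n -> R),
    [/\ S0 r0, forall i, S1 (r i) & a = iota r0 + \sum_i iota (r i) * x i].

Definition skew_relations (c : 'I_n -> 'I_n -> R) : Prop :=
  forall i j, c i j != 0 /\
    in_affine_span (fun=> True) (fun=> True)
      (x j * x i - iota (c i j) * x i * x j).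

Definition skew_PBW : Prop :=
  [/\ injective iota,
      left_basis (fun (r : R) (a : A) => iota r * a) smon,
      forall i (r : R), r != 0 -> exists c : R, c != 0 /\
        exists r', x i * iota r - iota c * x i = iota r'
    & exists c, skew_relations c].

Definition skew_derivation (s : R -> R) (delta : R -> R) : Prop :=
  (forall r t, delta (r + t) = delta r + delta t) /\
  (forall r t, delta (r * t) = s r * delta t + delta r * t).

(* These data always exist in a skew PBW extension, and they are uniquely
   determined by the freeness of A (for c, when it is invertible above the
   diagonal). *)
Definition skew_structure (sigma : 'I_n -> {rmorphism R -> R})
    (delta : 'I_n -> R -> R) (c : 'I_n -> 'I_n -> R) : Prop :=
  [/\ forall i, injective (sigma i),
      forall i, skew_derivation (sigma i) (delta i),
      forall i r, x i * iota r = iota (sigma i r) * x i + iota (delta i r)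
    & skew_relations c].

Definition bijective_structure (sigma : 'I_n -> {rmorphism R -> R})
    (c : 'I_n -> 'I_n -> R) : Prop :=
  (forall i, bijective (sigma i)) /\
  (forall i j : 'I_n, (i < j)%N -> exists u, u * c i j = 1 /\ c i j * u = 1).

Variable gR : nat -> R -> Prop.

Definition skew_grading (p : nat) : A -> Prop :=
  in_span (fun a => exists t r (alpha : {ffun 'I_n -> nat}),
    [/\ gR t r, (t + \sum_i alpha i)%N = p & a = iota r * smon alpha]).

Definition graded_skew_PBW : Prop :=
  [/\ graded_algebra gR, skew_PBW
    & exists sigma delta c,
      [/\ skew_structure sigma delta c /\ bijective_structure sigma c,
          forall i, skew_grading 1 (x i),
          forall i p r, gR p r -> gR p (sigma i r) /\ gR p.+1 (delta i r)
        & forall i j, gR 0 (c i j) /\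
            in_affine_span (gR 2) (gR 1)
              (x j * x i - iota (c i j) * x i * x j)]].

End SkewPBW.

(* Main.v *)
Require Import Defs.
From HB Require Import structures.
From mathcomp Require Import all_boot all_order all_algebra.
From mathcomp Require Import finmap monalg boolp.

Set Implicit Arguments.
Unset Strict Implicit.
Unset Printing Implicit Defensive.

(** Since [R] is connected, [R_+] generates on either side the same two-sided
    ideal of [A], and modulo it [A] becomes the quantum polynomial ring with
    [x_j x_i = k_ij x_i x_j]. Bijectivity of the [sigma_i] makes [A] free as a
    right [R]-module on the standard monomials, so tensoring a linear resolution
    of [K] over [R] with [A] gives a linear resolution of [A / A R_+]. Killing
    [x_1, ..., x_n] one after the other, right multiplication by the next
    variable is an injective [A]-linear endomorphism of degree 1, and the mapping
    cone of a lift of it to the resolution is again linear. After [n] steps this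
    resolves [K]. *)

Import GRing.Theory.
Local Open Scope ring_scope.

(** Neither quotients nor tensor products are formed: a left ideal [L] stands for [A / L], a free
    [R]-module is induced by copying its basis, and exactness is checked on components along the
    right basis or modulo [L]. Two leading-term arguments carry the algebra. Reordering a word costs
    a nonzero scalar, because [c i j] lies in [R_0 = K], and error terms with coefficients in [R_+];
    as [sigma i] preserves [R_+] and [delta i] maps [R] into it, a monomial times a variable is,
    modulo [R_+], a nonzero multiple of a single standard monomial. Regularity of the variables and
    stability of the ideals are read off from this. On the other side, [x^alpha r] is
    [sigma^alpha (r) x^alpha] up to monomials of smaller degree, which turns the left basis into a
    right one. *)

(** * Coordinates in direct sums and free modules *)

Lemma sub_morph0 (U V : zmodType) (f : U -> V) :
  (forall u v, f (u - v) = f u - f v) -> f 0 = 0.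
Proof. by move=> fB; rewrite -[X in f X](subrr 0) fB subrr. Qed.

Lemma sub_morphD (U V : zmodType) (f : U -> V) :
  (forall u v, f (u - v) = f u - f v) -> forall u v, f (u + v) = f u + f v.
Proof.
move=> fB u v.
by rewrite -{1}[v]opprK fB -[- v]sub0r fB (sub_morph0 fB) sub0r opprK.
Qed.

Lemma big_uniq_widen (I : eqType) (V : zmodType) (s t : seq I) (F : I -> V) :
    uniq s -> uniq t -> {subset s <= t} -> (forall i, i \notin s -> F i = 0) ->
  \sum_(i <- t) F i = \sum_(i <- s) F i.
Proof.
move=> us ut st F0.
rewrite (bigID (fun i => i \in s)) /= [X in _ + X]big1 ?addr0; last first.
  by move=> i /F0.
rewrite -big_filter; apply: perm_big; apply: uniq_perm => //.
  exact: filter_uniq.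
by move=> i; rewrite mem_filter; case: (boolP (i \in s)) => // /st ->.
Qed.

(* Common to [direct_sum] ([phi i] is the identity and [g i] the summand) and
   [left_basis] ([phi i] is the action on the basis vector, [g i] is trivial). *)
Section Coordinates.

Variables (I : eqType) (S V : zmodType) (g : I -> S -> Prop).
Variable phi : I -> S -> V.
Hypothesis phiB : forall i u v, phi i (u - v) = phi i u - phi i v.
Hypothesis g0 : forall i, g i 0.
Hypothesis gB : forall i u v, g i u -> g i v -> g i (u - v).

Let phi0 i : phi i 0 = 0. Proof. exact: sub_morph0 (phiB i). Qed.

(** Coordinates form a function on all of [I] that vanishes off a finite list. Unlike the list, this
    function is determined by [v] once [free] holds, so it can be chosen and subtracted. *)
Definition decomposes (v : V) (c : I -> S) : Prop :=
  (forall i, g i (c i)) /\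
  exists s, [/\ uniq s, forall i, i \notin s -> c i = 0
    & v = \sum_(i <- s) phi i (c i)].

Lemma decomposes_sub u v c d :
  decomposes u c -> decomposes v d -> decomposes (u - v) (fun i => c i - d i).
Proof.
move=> [gc [s [us c0 ->]]] [gd [t [ut d0 ->]]]; split.
  by move=> i; apply: gB.
exists (undup (s ++ t)); split; first exact: undup_uniq.
  by move=> i; rewrite mem_undup mem_cat negb_or => /andP[/c0 -> /d0 ->]; rewrite subrr.
rewrite -(big_uniq_widen (t := undup (s ++ t)) us) ?undup_uniq //; first last.
- by move=> i /c0 ->.
- by move=> i si; rewrite mem_undup mem_cat si.
rewrite -(big_uniq_widen (t := undup (s ++ t)) ut) ?undup_uniq //; first last.
- by move=> i /d0 ->.
- by move=> i si; rewrite mem_undup mem_cat si orbT.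
by rewrite -sumrB; apply: eq_bigr => i _; rewrite phiB.
Qed.

Lemma decomposes0 : decomposes 0 (fun=> 0).
Proof. by split=> //; exists [::]; rewrite big_nil. Qed.

Lemma decomposes_add u v c d :
  decomposes u c -> decomposes v d -> decomposes (u + v) (fun i => c i + d i).
Proof.
move=> hu hv; have := decomposes_sub hu (decomposes_sub decomposes0 hv).
by rewrite sub0r opprK; congr decomposes; apply: funext => i; rewrite sub0r opprK.
Qed.

Lemma decomposes1 i u :
  g i u -> decomposes (phi i u) (fun j => if j == i then u else 0).
Proof.
move=> gu; split; first by move=> j; case: eqP => [->|].
exists [:: i]; split=> //; first by move=> j; rewrite inE => /negPf ->.
by rewrite big_seq1 eqxx.
Qed.

Hypothesis span : forall v, exists (s : seq I) (c : I -> S),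
  (forall i, g i (c i)) /\ v = \sum_(i <- s) phi i (c i).
Hypothesis free : forall (s : seq I) (c : I -> S), uniq s ->
  (forall i, g i (c i)) -> \sum_(i <- s) phi i (c i) = 0 ->
  forall i, i \in s -> c i = 0.

Lemma decomposes_exists v : exists c, decomposes v c.
Proof.
have [s [c [gc ->]]] := span v; elim: s => [|i s [d hd]].
  by rewrite big_nil; exists (fun=> 0); apply: decomposes0.
by rewrite big_cons; eexists; apply: decomposes_add hd; apply: decomposes1.
Qed.

Lemma decomposes_inj v c d : decomposes v c -> decomposes v d -> c =1 d.
Proof.
move=> hc hd i; apply/eqP; rewrite -subr_eq0; apply/eqP.
have := decomposes_sub hc hd; rewrite subrr => -[gcd [s [us cd0 e]]].
by case: (boolP (i \in s)) => [|/cd0 //]; apply: free (esym e) _.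
Qed.

(** Coordinates are chosen vector by vector. They are additive by uniqueness: the difference of the
    decompositions chosen for [u] and [v] decomposes [u - v]. *)
Lemma coordinates_exist : exists co : I -> V -> S,
  [/\ forall i v, g i (co i v),
      forall i u v, co i (u - v) = co i u - co i v,
      forall v, exists s, [/\ uniq s, forall i, i \notin s -> co i v = 0
        & v = \sum_(i <- s) phi i (co i v)]
    & forall i u j, g i u -> co j (phi i u) = if j == i then u else 0].
Proof.
have [co coP] := choice decomposes_exists.
exists (fun i v => co v i); split.
- by move=> i v; case: (coP v).
- by move=> i u v; exact: (decomposes_inj (coP _) (decomposes_sub (coP u) (coP v))).
- by move=> v; case: (coP v).
- by move=> i u j gu; exact: (decomposes_inj (coP _) (decomposes1 gu)).
Qed.

End Coordinates.

Section DirectSum.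

Variables (I : eqType) (V : zmodType).
Implicit Type g : I -> V -> Prop.

Lemma direct_sum_proj g : direct_sum g -> exists pr : I -> V -> V,
  [/\ forall i v, g i (pr i v),
      forall i u v, pr i (u - v) = pr i u - pr i v,
      forall v, exists s, [/\ uniq s, forall i, i \notin s -> pr i v = 0
        & v = \sum_(i <- s) pr i v]
    & forall i v j, g i v -> pr j v = if j == i then v else 0].
Proof. by case=> g0 gB sp fr; apply: (@coordinates_exist I V V g (fun=> id)). Qed.

Lemma direct_sumD g i u v : direct_sum g -> g i u -> g i v -> g i (u + v).
Proof.
case=> g0 gB _ _ gu gv; rewrite -[v]opprK; apply: (gB i) => //.
by rewrite -sub0r; apply: gB.
Qed.

Lemma direct_sum_sum g i (J : Type) (s : seq J) (P : pred J) F :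
  direct_sum g -> (forall j, P j -> g i (F j)) -> g i (\sum_(j <- s | P j) F j).
Proof.
move=> dg gF; apply: (big_ind (g i)) => //; first by case: dg.
by move=> u v; apply: direct_sumD.
Qed.

(* Repetitions among the indices are allowed. *)
Lemma direct_sumI g : (forall i, g i 0) ->
    (forall i u v, g i u -> g i v -> g i (u - v)) ->
    (forall v, exists2 s : seq (I * V),
      forall iu, iu \in s -> g iu.1 iu.2 & v = \sum_(iu <- s) iu.2) ->
    (forall (s : seq I) (c : I -> V), uniq s -> (forall i, g i (c i)) ->
        \sum_(i <- s) c i = 0 -> forall i, i \in s -> c i = 0) ->
  direct_sum g.
Proof.
move=> g0 gB sp fr; split=> // v; have [s gs ->] := sp v.
suff [c [gc [t [_ _ e]]]] :
    exists c, decomposes g (fun=> id) (\sum_(iu <- s) iu.2) c.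
  by exists t, c.
elim: s gs => [|[i u] s IH] gs.
  by rewrite big_nil; exists (fun=> 0); apply: decomposes0.
have [|d hd] := IH; first by move=> iu si; apply: gs; rewrite inE si orbT.
rewrite big_cons; eexists; apply: decomposes_add hd => //.
by apply: (@decomposes1 I V V g (fun=> id) g0); apply: (gs (i, u)); rewrite inE eqxx.
Qed.

(** Each [g]-component of [v] is also [h]-homogeneous of the same index, so projecting the
    [g]-decomposition to [h] at [i] leaves [pg i v], while this projection fixes [v]. *)
Lemma direct_sum_eq g h : direct_sum g -> direct_sum h ->
  (forall i v, g i v -> h i v) -> forall i v, h i v -> g i v.
Proof.
move=> dg dh gh i v hv.
have [pg [pg1 _ pg3 _]] := direct_sum_proj dg.
have [ph [_ phB _ ph4]] := direct_sum_proj dh.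
suff -> : v = pg i v by [].
have : ph i v = v by rewrite (ph4 i) ?eqxx.
move=> {1}<-; have [s [us s0 e]] := pg3 v.
rewrite {1}e (big_morph _ (sub_morphD (phB i)) (sub_morph0 (phB i))).
rewrite (eq_bigr (fun j => if j == i then pg i v else 0)); last first.
  move=> j _; rewrite (ph4 j); last exact/gh/pg1.
  by rewrite eq_sym; case: eqP => [->|].
case: (boolP (i \in s)) => si.
  by rewrite (bigD1_seq i) //= eqxx big1 ?addr0 // => j /negPf ->.
rewrite (s0 _ si) big1 // => j _; by case: eqP.
Qed.

End DirectSum.

Lemma in_span_add (S : pzRingType) (V : lmodType S) (Y : V -> Prop) u v :
  in_span Y u -> in_span Y v -> in_span Y (u + v).
Proof.
move=> [s [hs ->]] [t [ht ->]]; exists (s ++ t); split; last by rewrite big_cat.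
by move=> cu; rewrite mem_cat => /orP[/hs|/ht].
Qed.

Lemma in_span0 (S : pzRingType) (V : lmodType S) (Y : V -> Prop) : in_span Y 0.
Proof. by exists [::]; rewrite big_nil. Qed.

Lemma in_span_scale (S : pzRingType) (V : lmodType S) (Y : V -> Prop) k u :
  Y u -> in_span Y (k *: u).
Proof.
move=> Yu; exists [:: (k, u)]; rewrite big_seq1; split=> // cu.
by rewrite inE => /eqP ->.
Qed.

(** The shape of a direct sum of copies of [S], with [phi x] as inclusions and [co x] as
    projections. Leaving [phi] arbitrary covers free modules as well as [A] seen over [R] through
    [iota]. *)
Definition coordinates (X : eqType) (S V : zmodType) (phi : X -> S -> V)
    (co : X -> V -> S) : Prop :=
  [/\ forall x u v, co x (u - v) = co x u - co x v,
      forall v, exists s, [/\ uniq s, forall x, x \notin s -> co x v = 0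
        & v = \sum_(x <- s) phi x (co x v)]
    & forall x r y, co y (phi x r) = if y == x then r else 0].

Section CoordinatesTheory.

Variables (X : eqType) (S V : zmodType) (phi : X -> S -> V) (co : X -> V -> S).
Hypothesis phiB : forall x r t, phi x (r - t) = phi x r - phi x t.
Hypothesis coP : coordinates phi co.

Lemma coords0 x : co x 0 = 0.
Proof. by case: coP => coB _ _; apply: sub_morph0 (coB x). Qed.

Lemma coordsD x u v : co x (u + v) = co x u + co x v.
Proof. by case: coP => coB _ _; apply: sub_morphD (coB x) u v. Qed.

Lemma coords_sum x (J : Type) (s : seq J) (P : pred J) F :
  co x (\sum_(j <- s | P j) F j) = \sum_(j <- s | P j) co x (F j).
Proof. exact: (big_morph (co x) (coordsD x) (coords0 x)). Qed.

Lemma coords_phi0 x : phi x 0 = 0.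
Proof. exact: sub_morph0 (phiB x). Qed.

Lemma coords_phiD x r t : phi x (r + t) = phi x r + phi x t.
Proof. exact: sub_morphD (phiB x) r t. Qed.

Lemma coords_inj0 v : (forall x, co x v = 0) -> v = 0.
Proof.
case: coP => _ /(_ v)[s [_ _ e]] _ v0; rewrite e big1 // => x _.
by rewrite v0 coords_phi0.
Qed.

Lemma coords_ind (Q : V -> Prop) : Q 0 -> (forall u v, Q u -> Q v -> Q (u + v)) ->
  (forall x r, Q (phi x r)) -> forall v, Q v.
Proof.
case: coP => _ e _ Q0 QD Qphi v; have [s [_ _ ->]] := e v.
exact: (big_ind Q).
Qed.

Lemma coords_ext (N : zmodType) (psi : X -> S -> N) :
    (forall x r t, psi x (r - t) = psi x r - psi x t) ->
  exists h : V -> N, (forall u v, h (u - v) = h u - h v) /\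
    forall x r, h (phi x r) = psi x r.
Proof.
case: coP => coB e co1 psiB.
have psi0 x : psi x 0 = 0 by exact: sub_morph0 (psiB x).
have [supp suppP] := choice e.
pose h v := \sum_(x <- supp v) psi x (co x v).
(* Any duplicate-free list containing the chosen support gives the same value, so additivity can be
   tested on one list common to [u], [v] and [u - v]. *)
have hE v t : uniq t -> {subset supp v <= t} -> h v = \sum_(x <- t) psi x (co x v).
  move=> ut st; have [us s0 _] := suppP v; symmetry; apply: big_uniq_widen => //.
  by move=> x /s0 ->.
exists h; split=> [u v|x r].
  pose t := undup (supp u ++ supp v ++ supp (u - v)).
  have ut : uniq t by apply: undup_uniq.
  rewrite !(hE _ t) //.
  - by rewrite -sumrB; apply: eq_bigr => x _; rewrite coB psiB.
  - by move=> x xs; rewrite mem_undup !mem_cat xs ?orbT.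
  - by move=> x xs; rewrite mem_undup !mem_cat xs ?orbT.
  - by move=> x xs; rewrite mem_undup !mem_cat xs ?orbT.
pose t := undup (x :: supp (phi x r)).
have ut : uniq t by apply: undup_uniq.
have xt : x \in t by rewrite mem_undup inE eqxx.
rewrite (hE _ t) //; last by move=> y ys; rewrite mem_undup inE ys orbT.
rewrite (bigD1_seq x) //= co1 eqxx big1 ?addr0 // => y /negPf yx.
by rewrite co1 yx psi0.
Qed.

End CoordinatesTheory.

Lemma left_basis_coord (X : eqType) (S : pzRingType) (V : zmodType)
    (act : S -> V -> V) (e : X -> V) :
    (forall r t v, act (r - t) v = act r v - act t v) -> left_basis act e ->
  exists co, coordinates (fun x r => act r (e x)) co.
Proof.
move=> actB [sp fr].
have [co [_ coB coE co1]] := @coordinates_exist X S V (fun _ _ => True)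
  (fun x r => act r (e x)) (fun x r t => actB r t (e x)) (fun=> I) (fun _ _ _ _ _ => I)
  (fun v => let: ex_intro s (ex_intro c vE) := sp v in
    ex_intro _ s (ex_intro _ c (conj (fun=> I) vE)))
  (fun s c us _ => fr s c us).
by exists co; split=> // x r y; apply: co1.
Qed.

Lemma coord_left_basis (X : eqType) (S : pzRingType) (V : zmodType)
    (act : S -> V -> V) (e : X -> V) co :
  coordinates (fun x r => act r (e x)) co -> left_basis act e.
Proof.
move=> coP; have [coB coE co1] := coP; split=> [v|s c us c0 x xs].
  by have [s [_ _ ->]] := coE v; exists s, (co^~ v).
have := coords_sum coP x s xpredT (fun y => act (c y) (e y)).
rewrite c0 (coords0 coP) (bigD1_seq x) //= co1 eqxx big1 ?addr0 //.
by move=> y /negPf yx; rewrite co1 eq_sym yx.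
Qed.

Lemma coords_scale (X : eqType) (S : pzRingType) (V : zmodType)
    (act : S -> V -> V) (e : X -> V) co :
    (forall r u v, act r (u + v) = act r u + act r v) ->
    (forall r t v, act r (act t v) = act (r * t) v) ->
  coordinates (fun x r => act r (e x)) co ->
  forall x r v, co x (act r v) = r * co x v.
Proof.
move=> actD actA coP x r; apply: (coords_ind coP).
- have act0 : act r 0 = 0 by apply: (addrI (act r 0)); rewrite -actD !addr0.
  by rewrite act0 (coords0 coP) mulr0.
- by move=> u v hu hv; rewrite actD !(coordsD coP) hu hv mulrDr.
- move=> y t; have [_ _ co1] := coP.
  by rewrite actA !co1; case: eqP => _; rewrite ?mulr0.
Qed.

(** * Graded free modules and homogeneous lifts *)

(** Algebras are graded by naturals, modules by integers. Extension by zero gives a meaning to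
    degree [q - deg x], and later makes coordinates at monomials of too large degree vanish. *)
Definition int_gr (V : zmodType) (gr : nat -> V -> Prop) (q : int) (v : V) :=
  if q is Posz p then gr p v else v = 0.

Section GradedSums.

Variable V : zmodType.

Lemma int_gr_direct_sum (gr : nat -> V -> Prop) :
  direct_sum gr -> direct_sum (int_gr gr).
Proof.
move=> dg; have [g0 gB sp fr] := dg; apply: direct_sumI.
- by case=> // p; apply: g0.
- by case=> [p|p] u v; [apply: gB|move=> /= -> ->; rewrite subrr].
- move=> v; have [s [c [gc ->]]] := sp v.
  exists [seq (Posz p, c p) | p <- s]; last by rewrite big_map.
  by move=> _ /mapP[p _ ->] /=.
- move=> s c us gc c0 q qs; case: q qs => [p|p] qs; last exact: (gc (Negz p)).
  pose t := [seq absz q | q <- s & (0 <= q)].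
  have memt k : (k \in t) = (Posz k \in s).
    apply/mapP/idP => [[q]|ks].
      by rewrite mem_filter => /andP[]; case: q => // m _ ms ->.
    by exists (Posz k); rewrite ?mem_filter ?ks.
  apply: (fr t (fun p => c (Posz p))); rewrite ?memt //.
  - rewrite map_inj_in_uniq ?filter_uniq // => x y.
    rewrite !mem_filter => /andP[x0 _] /andP[y0 _].
    by case: x y x0 y0 => // a [] // b _ _ /= ->.
  - by move=> k; exact: (gc (Posz k)).
  - rewrite big_map big_filter -[RHS]c0 [RHS](bigID (fun q : int => 0 <= q)) /=.
    rewrite [X in _ = _ + X]big1 ?addr0; first by apply: eq_bigr; case.
    by case=> // k _; exact: (gc (Negz k)).
Qed.

Lemma nat_direct_sum (h : int -> V -> Prop) : direct_sum h ->
  (forall p v, h (Negz p) v -> v = 0) -> direct_sum (fun p => h (Posz p)).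
Proof.
move=> [h0 hB sp fr] hneg; apply: direct_sumI => [p|p u v|v|s c us hc c0 p ps].
- exact: h0.
- exact: hB.
- have [s [c [hc ->]]] := sp v; elim: s => [|[p|p] s [t ht e]].
  + by exists [::] => //; rewrite !big_nil.
  + exists ((p, c (Posz p)) :: t); last by rewrite !big_cons e.
    by move=> iu; rewrite inE => /orP[/eqP -> /=|/ht].
  + by exists t; rewrite // big_cons (hneg p _ (hc (Negz p))) add0r.
- pose d (q : int) := if q is Posz p then c p else 0.
  apply: (fr [seq Posz p | p <- s] d _ _ _ (Posz p)).
  + by rewrite map_inj_uniq // => x y [].
  + by case=> [k|k] /=; [apply: hc|apply: h0].
  + by rewrite big_map.
  + exact: map_f.
Qed.

Variables (X : eqType) (S : zmodType) (phi : X -> S -> V) (co : X -> V -> S).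
Hypothesis phiB : forall x r t, phi x (r - t) = phi x r - phi x t.
Hypothesis coP : coordinates phi co.

(** The copy of [S] at [x] is shifted by [deg x]. This serves both for graded free modules and for
    [A] over [R], where [deg] is the degree of a monomial. *)
Lemma coord_direct_sum (gS : int -> S -> Prop) (deg : X -> int) :
  direct_sum gS -> direct_sum (fun q v => forall x, gS (q - deg x) (co x v)).
Proof.
move=> dS; have [coB coE co1] := coP; have [S0 SB spS frS] := dS.
apply: direct_sumI => [q x|q u v gu gv x|v|s c us gc c0 q qs].
- by rewrite (coords0 coP); apply: S0.
- by rewrite coB; apply: SB.
- move: v; apply: (coords_ind coP).
  + by exists [::]; rewrite ?big_nil.
  + move=> u v [s hs ->] [t ht ->]; exists (s ++ t); last by rewrite big_cat.
    by move=> iu; rewrite mem_cat => /orP[/hs|/ht].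
  + move=> x r; have [s [c [gc ->]]] := spS r.
    exists [seq (q + deg x, phi x (c q)) | q <- s].
      move=> _ /mapP[q _ ->] /= y; rewrite co1; case: eqP => [->|_]; last exact: S0.
      by rewrite addrK.
    rewrite big_map /=.
    elim: s => [|q s IH]; first by rewrite !big_nil (coords_phi0 phiB).
    by rewrite !big_cons (coords_phiD phiB) IH.
- apply: (coords_inj0 phiB coP) => x.
  pose d z := co x (c (z + deg x)).
  have := frS [seq q - deg x | q <- s] d _ _ _ (q - deg x).
  rewrite /d subrK; apply.
  + by rewrite map_inj_uniq //; apply: addIr.
  + by move=> z; have := gc (z + deg x) x; rewrite addrK.
  + rewrite big_map -[RHS](coords0 coP x) -c0 (coords_sum coP).
    by apply: eq_bigr => z _; rewrite subrK.
  + exact: (map_f (fun q => q - deg x)).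
Qed.

End GradedSums.

Section GradedFree.

Variables (K : fieldType) (B : algType K) (gr : nat -> B -> Prop).
Hypothesis gB : graded_algebra gr.

Lemma int_gr_mul p q b c : int_gr gr p b -> int_gr gr q c -> int_gr gr (p + q) (b * c).
Proof.
case: gB => dg _ _ gM; have [h0 _ _ _] := int_gr_direct_sum dg.
case: p => [p|p] /= hb; last by rewrite hb mul0r => _; apply: h0.
case: q => [q|q] /= hc; last by rewrite hc mulr0; apply: (h0 (Posz p + Negz q)).
exact: gM.
Qed.

Variables (M : lmodType B) (gM : int -> M -> Prop).

Lemma graded_module_int q t b v : graded_module gr gM ->
  int_gr gr q b -> gM t v -> gM (q + t) (b *: v).
Proof.
case=> [[g0 _ _ _] gmul]; case: q => [p|p] /= hb hv; first exact: gmul.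
by rewrite hb scale0r; apply: g0.
Qed.

(** Only a homogeneous basis is given. Having homogeneous coordinates defines a second grading,
    contained in [gM], and [direct_sum_eq] forces the two to coincide. *)
Lemma graded_free_coord : graded_free gr gM -> exists (X : eqType) (e : X -> M)
    (deg : X -> int) (co : X -> M -> B),
  [/\ forall x, gM (deg x) (e x), coordinates (fun x b => b *: e x) co
    & forall q v x, gM q v -> int_gr gr (q - deg x) (co x v)].
Proof.
case: (gB) => dg _ _ _ [gm [X [e [deg [ge /left_basis_coord[]]]]]].
  by move=> r t v; rewrite scalerBl.
move=> co coP; exists X, e, deg, co; split=> // q v x gv.
have phiB y (r t : B) : (r - t) *: e y = r *: e y - t *: e y by rewrite scalerBl.
have dh := coord_direct_sum phiB coP deg (int_gr_direct_sum dg).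
case: (gm) => dM _; apply: (direct_sum_eq dh dM _ gv) => {x gv v}t v hv.
have [_ coE _] := coP; have [s [_ _ ->]] := coE v.
apply: direct_sum_sum => // x _; rewrite -[t](subrK (deg x)).
exact: graded_module_int.
Qed.

Lemma linear_lift (X : eqType) (e : X -> M) co (N : lmodType B) (f : X -> N) :
    coordinates (fun x b => b *: e x) co ->
  exists h : {linear M -> N}, forall x, h (e x) = f x.
Proof.
move=> coP.
have [|h [hB h1]] := coords_ext coP (psi := fun x b => b *: f x).
  by move=> x r t; rewrite scalerBl.
have h0 := sub_morph0 hB; have hD := sub_morphD hB.
have hZ b v : h (b *: v) = b *: h v.
  move: v; apply: (coords_ind coP) => [|u v hu hv|x c].
  - by rewrite !(scaler0, h0).
  - by rewrite scalerDr !hD hu hv scalerDr.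
  - by rewrite scalerA !h1 scalerA.
have hl : linear h by move=> b u v; rewrite hD hZ.
pose hL : {linear M -> N} := HB.pack h (GRing.isLinear.Build B M N *:%R h hl).
by exists hL => x; rewrite -[e x]scale1r /= h1 scale1r.
Qed.

End GradedFree.

(** By freeness it suffices to find a [Q]-partner of each basis vector. A relation [Q] compatible
    with the module operations covers both uses: lifting modulo a left ideal and lifting along a
    differential. *)
Lemma graded_lift (K : fieldType) (B : algType K) (gr : nat -> B -> Prop)
    (M N : lmodType B) (gM : int -> M -> Prop) (gN : int -> N -> Prop) (m : int)
    (Q : M -> N -> Prop) :
    graded_algebra gr -> graded_free gr gM -> graded_module gr gN ->
    Q 0 0 -> (forall u v u' v', Q u u' -> Q v v' -> Q (u + v) (u' + v')) ->
    (forall b u u', Q u u' -> Q (b *: u) (b *: u')) ->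
    (forall q v, gM q v -> exists2 w, gN (q + m) w & Q v w) ->
  exists h : {linear M -> N}, (forall v, Q v (h v)) /\
    forall q v, gM q v -> gN (q + m) (h v).
Proof.
move=> gB fM gN' Q0 QD QZ Qex.
have [X [e [deg [co [ge coP gco]]]]] := graded_free_coord gB fM.
have /choice[f fP] : forall x, exists w, gN (deg x + m) w /\ Q (e x) w.
  by move=> x; have [w] := Qex _ _ (ge x); exists w.
have [h hE] := linear_lift f coP; exists h; split.
  apply: (coords_ind coP) => [|u v|x b]; first by rewrite raddf0.
    by rewrite raddfD; apply: QD.
  by rewrite linearZ hE /=; apply: QZ; case: (fP x).
move=> q v gv; have [_ coE _] := coP; have [s [_ _ ->]] := coE v.
rewrite raddf_sum; apply: direct_sum_sum; first by case: gN'.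
move=> x _ /=; rewrite linearZ hE /= -[q](subrK (deg x)) -addrA.
by apply: (graded_module_int gN'); [apply: gco | case: (fP x)].
Qed.

(** A degree-preserving map commutes with taking components, so the component of [w] at [i] will
    do. *)
Lemma homogeneous_preimage (I : eqType) (M N : zmodType) (gM : I -> M -> Prop)
    (gN : I -> N -> Prop) (h : {additive M -> N}) i w :
    direct_sum gM -> direct_sum gN -> (forall j v, gM j v -> gN j (h v)) ->
  gN i (h w) -> exists2 w', gM i w' & h w' = h w.
Proof.
move=> dM dN gh ghw.
have [pM [pM1 _ pM3 _]] := direct_sum_proj dM.
have [pN [pN1 pNB pN3 pN4]] := direct_sum_proj dN.
exists (pM i w) => //.
have : pN i (h w) = h w by rewrite (pN4 i) ?eqxx.
have [s [us s0 e]] := pM3 w.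
rewrite {1}e raddf_sum (big_morph _ (sub_morphD (pNB i)) (sub_morph0 (pNB i))).
rewrite (eq_bigr (fun j => if j == i then h (pM i w) else 0)); last first.
  move=> j _; rewrite (pN4 j); last exact/gh/pM1.
  by rewrite eq_sym; case: eqP => [->|].
case: (boolP (i \in s)) => si.
  by rewrite (bigD1_seq i) //= eqxx big1 ?addr0 // => j /negPf ->.
rewrite (s0 _ si) raddf0 big1 // => j _; by case: eqP.
Qed.

(** * Mapping cones *)

Section PairModules.

Variables (K : fieldType) (B : algType K) (gr : nat -> B -> Prop).
Hypothesis gB : graded_algebra gr.
Variables (M N Q : lmodType B) (gM : int -> M -> Prop) (gN : int -> N -> Prop).

(** The second summand is [N(-1)]: on it a chain map that raises degrees by one becomes
    degree-preserving. *)
Definition cone_gr (q : int) (v : M * N) : Prop := gM q v.1 /\ gN (q - 1) v.2.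

Lemma cone_direct_sum : direct_sum gM -> direct_sum gN -> direct_sum cone_gr.
Proof.
move=> [M0 MB spM frM] [N0 NB spN frN]; apply: direct_sumI.
- by move=> q; split; [apply: M0|apply: N0].
- by move=> q u v [? ?] [? ?]; split; [apply: MB|apply: NB].
- move=> [v w]; have [s [c [gc ->]]] := spM v; have [t [d [gd ->]]] := spN w.
  exists ([seq (q, (c q, 0)) | q <- s] ++ [seq (q + 1, (0, d q)) | q <- t]).
    move=> iu; rewrite mem_cat => /orP[] /mapP[q _ ->]; split=> //=.
    by rewrite addrK.
  rewrite big_cat !big_map /= [LHS](_ : _ = (\sum_(q <- s) c q, 0) +
    (0, \sum_(q <- t) d q)); last by congr pair; rewrite /= ?addr0 ?add0r.
  congr (_ + _).
    elim: s => [|q s IH]; rewrite ?big_nil // !big_cons -IH.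
    by congr pair; rewrite /= addr0.
  elim: t => [|q s' IH]; rewrite ?big_nil // !big_cons -IH.
  by congr pair; rewrite /= addr0.
- move=> s c us gc c0 q qs.
  have c1 : \sum_(q <- s) (c q).1 = 0.
    by rewrite -(raddf_sum (fst : {additive M * N -> M})) c0.
  have c2 : \sum_(q <- s) (c q).2 = 0.
    by rewrite -(raddf_sum (snd : {additive M * N -> N})) c0.
  rewrite [c q]surjective_pairing (frM s (fun q => (c q).1)) //; last first.
    by move=> i; case: (gc i).
  have := frN [seq z - 1 | z <- s] (fun z => (c (z + 1)).2) _ _ _ (q - 1).
  rewrite subrK => ->//.
  + by rewrite map_inj_uniq //; apply: addIr.
  + by move=> i; have [_] := gc (i + 1); rewrite addrK.
  + by rewrite big_map -[RHS]c2; apply: eq_bigr => z _; rewrite subrK.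
  + exact: (map_f (fun q => q - 1)).
Qed.

Lemma cone_graded_free :
  graded_free gr gM -> graded_free gr gN -> graded_free gr cone_gr.
Proof.
move=> fM fN.
have [X [e [deg [co [ge coP gco]]]]] := graded_free_coord gB fM.
have [Y [e' [deg' [co' [ge' coP' gco']]]]] := graded_free_coord gB fN.
have [[dM mM] _] := fM; have [[dN mN] _] := fN.
split; first split; first exact: cone_direct_sum.
  move=> p q b v gb [g1 g2]; split; first exact: mM.
  by rewrite -addrA; apply: mN.
pose E (z : X + Y) : M * N := match z with inl x => (e x, 0) | inr y => (0, e' y) end.
pose D (z : X + Y) := match z with inl x => deg x | inr y => deg' y + 1 end.
exists (X + Y)%type, E, D; split.
  have [M0 _ _ _] := dM; have [N0 _ _ _] := dN.
  by case=> x; split=> //=; rewrite addrK.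
pose C (z : X + Y) (v : M * N) := match z with inl x => co x v.1 | inr y => co' y v.2 end.
apply: (@coord_left_basis _ _ _ _ _ C).
have [cB cE c1] := coP; have [cB' cE' c1'] := coP'.
split.
- by case=> x u v; [apply: cB|apply: cB'].
- move=> [v w]; have [s [us s0 sE]] := cE v; have [t [ut t0 tE]] := cE' w.
  exists ([seq inl x | x <- s] ++ [seq inr x | x <- t]); split.
  + rewrite cat_uniq !map_inj_uniq ?us ?ut ?andbT /=; last by move=> ? ? [].
      by apply/hasPn => _ /mapP[y _ ->]; apply/mapP => -[].
    by move=> ? ? [].
  + case=> x; rewrite mem_cat negb_or => /andP[h1 h2] /=.
      by apply: s0; apply: contraNN h1 => /(map_f inl).
    by apply: t0; apply: contraNN h2 => /(map_f inr).
  + rewrite big_cat !big_map /= [LHS](_ : _ = (v, 0) + (0, w)); last first.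
      by congr pair; rewrite /= ?addr0 ?add0r.
    congr (_ + _).
      rewrite {1}sE; elim: (s) => [|q s' IH]; rewrite ?big_nil // !big_cons -IH.
      by congr pair; rewrite /= scaler0 addr0.
    rewrite {1}tE; elim: (t) => [|q s' IH]; rewrite ?big_nil // !big_cons -IH.
    by congr pair; rewrite /= scaler0 addr0.
- case=> x r [] y /=.
  + by rewrite c1.
  + by rewrite scaler0 (coords0 coP').
  + by rewrite scaler0 (coords0 coP).
  + by rewrite c1'.
Qed.

Lemma cone_generated (q : int) :
    generated_in_degree gM (q + 1) -> generated_in_degree gN q ->
    direct_sum gM -> direct_sum gN ->
  generated_in_degree cone_gr (q + 1).
Proof.
move=> hM hN [M0 _ _ _] [N0 _ _ _] [v w].
have [s [hs ->]] := hM v; have [t [ht ->]] := hN w.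
exists ([seq (cu.1, (cu.2, 0)) | cu <- s] ++ [seq (cu.1, (0, cu.2)) | cu <- t]).
split.
  move=> cu; rewrite mem_cat => /orP[] /mapP[z zs ->]; split=> //=.
    exact: hs.
  by rewrite addrK; apply: ht.
rewrite big_cat !big_map /= [LHS](_ : _ = (\sum_(cu <- s) cu.1 *: cu.2, 0) +
    (0, \sum_(cu <- t) cu.1 *: cu.2)); last by congr pair; rewrite /= ?addr0 ?add0r.
congr (_ + _).
  elim: (s) => [|z s' IH]; rewrite ?big_nil // !big_cons -IH.
  by congr pair; rewrite /= scaler0 addr0.
elim: (t) => [|z s' IH]; rewrite ?big_nil // !big_cons -IH.
by congr pair; rewrite /= scaler0 addr0.
Qed.

Variables (d : {linear M -> Q}) (f : {linear N -> Q}).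

Definition cone_d0 (v : M * N) : Q := d v.1 + f v.2.

Lemma cone_d0_linear : linear cone_d0.
Proof. by move=> b u v; rewrite /cone_d0 !linearP scalerDr addrACA. Qed.

HB.instance Definition _ := GRing.isLinear.Build B _ _ _ cone_d0 cone_d0_linear.

Variables (T : lmodType B) (d' : {linear N -> T}).

(** The sign makes successive differentials of the cone compose to zero when the lifted maps commute
    with the differentials of the resolution. *)
Definition cone_d1 (v : M * N) : Q * T := (cone_d0 v, - d' v.2).

Lemma cone_d1_linear : linear cone_d1.
Proof.
move=> b u v; rewrite /cone_d1 linearP /=; congr pair; rewrite /=.
by rewrite linearP opprD scalerN.
Qed.

HB.instance Definition _ := GRing.isLinear.Build B _ _ _ cone_d1 cone_d1_linear.

End PairModules.

(** * Linear resolutions modulo a left ideal, and the cone step *)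

Section Resolutions.

Variables (K : fieldType) (A : algType K) (gr : nat -> A -> Prop).
Hypothesis gA : graded_algebra gr.

(* The quotient [A/L] is avoided: its augmentation [P 0 -> A/L] lifts to [A]
   because [P 0] is free. *)
Definition linear_resolution_of (L : A -> Prop) (P : nat -> lmodType A)
    (gP : forall i, int -> P i -> Prop) (d : forall i, {linear P i.+1 -> P i})
    (pi : {additive P 0 -> A}) : Prop :=
  [/\ forall i, graded_free gr (@gP i) /\ generated_in_degree (@gP i) i%:Z,
      forall i (q : int) (v : P i.+1), gP i.+1 q v -> gP i q (d i v),
      [/\ forall a v, pi (a *: v) = a * pi v,
          forall (q : int) (v : P 0), gP 0 q v -> int_gr gr q (pi v)
        & exists v0 : P 0, gP 0 0 v0 /\ L (pi v0 - 1)],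
      forall v, L (pi v) <-> exists w, d 0 w = v
    & forall i v, d i v = 0 <-> exists w, d i.+1 w = v].

Definition has_linear_resolution (L : A -> Prop) : Prop :=
  exists P gP d pi, @linear_resolution_of L P gP d pi.

Definition left_ideal (L : A -> Prop) : Prop :=
  [/\ L 0, forall a b, L a -> L b -> L (a + b) & forall a b, L b -> L (a * b)].

Section Cone.

Variables (L : A -> Prop) (x : A).
Hypothesis idL : left_ideal L.
Hypothesis x1 : gr 1 x.
Hypothesis Lx : forall a, L a -> L (a * x).
Hypothesis xL : forall a, L (a * x) -> L a.

Let LN a : L a -> L (- a).
Proof. by case: idL => _ _ LM; rewrite -mulN1r; apply: (LM). Qed.

Variables (P : nat -> lmodType A) (gP : forall i, int -> P i -> Prop).
Arguments gP : clear implicits.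
Variables (d : forall i, {linear P i.+1 -> P i}) (pi : {additive P 0 -> A}).
Hypothesis resP : linear_resolution_of L gP d pi.

Let gfree i : graded_free gr (gP i). Proof. by case: resP => /(_ i)[]. Qed.
Let gmod i : graded_module gr (gP i). Proof. by case: (gfree i). Qed.
Let gsum i : direct_sum (gP i). Proof. by case: (gmod i). Qed.
Let dd i v : d i (d i.+1 v) = 0.
Proof. by case: resP => _ _ _ _ /(_ i) h; apply/h; exists v. Qed.

(** The second clause says that [f] preserves the image of [d i]. It is carried along because the
    next lift needs it, so that the whole chain map can be built by recursion. *)
Let lift i : Type := {f : {linear P i -> P i} |
  (forall q v, gP i q v -> gP i (q + 1) (f v)) /\
  forall w, exists w', d i w' = f (d i w)}.

Lemma lift0 : exists f : lift 0, forall v, L (pi (sval f v) - pi v * x).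
Proof.
have [L0 LD LM] := idL; have [_ _ [piZ gpi [v0 [g0 Lv0]]] exact0 _] := resP.
have [|||q v gv|f [fQ fg]] := @graded_lift K A gr (P 0) (P 0) (gP 0) (gP 0) 1
    (fun v w => L (pi w - pi v * x)) gA (gfree 0) (gmod 0).
- by rewrite raddf0 mul0r subrr.
- move=> u v u' v' hu hv; rewrite !raddfD /= mulrDl opprD addrACA; exact: LD.
- move=> b u u' hu; rewrite !piZ -mulrA -mulrBr; exact: LM.
(* [pi v0] is 1 modulo [L], so this multiple of [v0] has augmentation [pi v * x] modulo [L]; as [v0]
   has degree 0, the degree grows by one only. *)
- exists ((pi v * x) *: v0).
    rewrite -[q + 1]addr0; apply: (graded_module_int (gmod 0)) => //.
    exact: (int_gr_mul gA (gpi _ _ gv) (q := 1)).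
  by rewrite piZ -[X in _ - X]mulr1 -mulrBr; apply: (LM).
(* The augmentation of a boundary lies in [L], which is stable under right multiplication by [x];
   exactness makes the image under [f] a boundary again. *)
have fd w : exists w', d 0 w' = f (d 0 w).
  apply/exact0; rewrite -[pi _](subrK (pi (d 0 w) * x)).
  by apply: LD (fQ _) (Lx _); apply/exact0; exists w.
by exists (exist _ f (conj fg fd)).
Qed.

Lemma lift_step i (f : lift i) :
  exists f' : lift i.+1, forall v, d i (sval f' v) = sval f (d i v).
Proof.
case: f => f [fg fd] /=; have [_ gd _ _ exS] := resP.
have [|||q v gv|f' [fQ fg']] := @graded_lift K A gr (P i.+1) (P i.+1)
    (gP i.+1) (gP i.+1) 1 (fun v w => d i w = f (d i v)) gA (gfree _) (gmod _).
- by rewrite !raddf0.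
- by move=> u v u' v' hu hv; rewrite !linearD hu hv.
- by move=> b u u' hu; rewrite !linearZ /= hu.
(* [w] is some preimage of [f (d i v)]; its component of degree [q + 1] is one too. *)
- have [w e] := fd v.
  have [||||w' gw' e'] := @homogeneous_preimage _ _ _ (gP i.+1) (gP i) (d i) (q + 1) w.
  + exact: gsum.
  + exact: gsum.
  + exact: gd.
  + by change (gP i (q + 1) (d i w)); rewrite e; apply/fg/gd.
  + by exists w'; rewrite // -e; apply: e'.
have fd' w : exists w', d i.+1 w' = f' (d i.+1 w).
  by apply/exS; rewrite fQ dd raddf0.
by exists (exist _ f' (conj fg' fd')).
Qed.

Definition cone_mod i : lmodType A :=
  if i is j.+1 then (P j.+1 * P j)%type : lmodType A else P 0.

Definition cone_mod_gr i : int -> cone_mod i -> Prop :=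
  match i with
  | 0 => gP 0
  | j.+1 => cone_gr (gP j.+1) (gP j)
  end.

Definition cone_diff (f : forall i, {linear P i -> P i}) i :
    {linear cone_mod i.+1 -> cone_mod i} :=
  match i with
  | 0 => cone_d0 (d 0) (f 0) : {linear (P 1 * P 0)%type -> P 0}
  | j.+1 => cone_d1 (d j.+1) (f j.+1) (d j) :
      {linear (P j.+2 * P j.+1)%type -> (P j.+1 * P j)%type}
  end.

(** [Lx] makes right multiplication by [x] an endomorphism of [A/L], with cokernel [A/L'], and [xL]
    makes it injective. The cone of the lifted chain map thus has no homology but this cokernel, in
    homological degree 0. *)
Lemma has_linear_resolution_cone (L' : A -> Prop) :
    (forall a, L' a <-> exists l b, L l /\ a = l + b * x) ->
  has_linear_resolution L'.
Proof.
move=> L'E; have [L0 LD LM] := idL.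
have [gens gd [piZ gpi [v0 [g0 Lv0]]] ex0 exS] := resP.
have [f0 f0P] := lift0.
pose F := nat_rect lift f0 (fun i f => sval (cid (lift_step f))).
pose f i := sval (F i).
have f0E v : L (pi (f 0 v) - pi v * x) by apply: f0P.
have fE i v : d i (f i.+1 v) = f i (d i v) by apply: (svalP (cid (lift_step (F i)))).
have fg i q v : gP i q v -> gP i (q + 1) (f i v) by case: (svalP (F i)) => + _; apply.
exists cone_mod, cone_mod_gr, (cone_diff f), pi; split.
- case=> [|i]; first exact: gens.
  split; first by apply: cone_graded_free.
  have -> : i.+1%:Z = i%:Z + 1 :> int by rewrite -addn1 PoszD.
  apply: cone_generated => //; last by case: (gens i).
  by case: (gens i.+1) => _; rewrite -addn1 PoszD.
- have gfq i q v : gP i (q - 1) v -> gP i q (f i v) by move=> /fg; rewrite subrK.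
  case=> [|i] q [v w] [/= gv gw].
    by apply: direct_sumD (gd _ _ _ gv) (gfq _ _ _ gw).
  split=> /=; first exact: direct_sumD (gd _ _ _ gv) (gfq _ _ _ gw).
  by have [N0 NB _ _] := gsum i; rewrite -[- d _ _]sub0r; apply: NB => //; apply: gd.
- split=> //; exists v0; split=> //; apply/L'E; exists (pi v0 - 1), 0.
  by rewrite mul0r addr0.
- move=> v; split.
    move=> /L'E[l [b [Ll e]]].
    (* [pi u] is [b] modulo [L], so subtracting [f 0 u] cancels the term [b * x] modulo [L]. *)
    pose u := b *: v0.
    have [w wE] : exists w, d 0 w = v - f 0 u.
      apply/ex0; rewrite raddfB e /= .
      have -> : l + b * x - pi (f 0 u) =
          l - (pi (f 0 u) - pi u * x) - (b * (pi v0 - 1)) * x.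
        by rewrite /u piZ mulrBr mulr1 mulrBl !opprB -!addrA; congr (_ + _);
          rewrite [RHS]addrA [RHS]addrC !addrA subrK.
      by apply: (LD); [apply: (LD) => //; apply: LN | apply: LN; apply/Lx/LM].
    by exists (w, u); rewrite /= /cone_d0 /= wE subrK.
  move=> [[w u] <-]; apply/L'E; rewrite /= /cone_d0 /= raddfD /=.
  exists (pi (d 0 w) + (pi (f 0 u) - pi u * x)), (pi u).
  by rewrite -addrA subrK; split=> //; apply: (LD) => //; apply/ex0; exists w.
- case=> [|i] [v w] /=; rewrite /cone_d0 /=; split.
  (* Here injectivity of multiplication by [x] enters: [pi w * x] lies in [L], hence so does [pi w],
     and [w] is a boundary. *)
  + move=> e; have [u uE] : exists u, d 0 u = w.
      apply/ex0/xL; have -> : pi w * x = pi (f 0 w) - (pi (f 0 w) - pi w * x).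
        by rewrite opprB addrC subrK.
      apply: (LD); last exact: LN.
      apply/ex0; exists (- v); rewrite raddfN; apply/esym/eqP.
      by rewrite -addr_eq0 addrC e.
    (* The preimage will be [(t, - u)]: the sign in [cone_d1] turns [- u] back into [w], and the
       extra [f 1 u] in [d 1 t] cancels [f 1 (- u)]. *)
    have [t tE] : exists t, d 1 t = v + f 1 u.
      by apply/exS; rewrite linearD fE uE.
    by exists (t, - u); rewrite /cone_d1 /cone_d0 /= tE !linearN opprK uE addrK.
  + move=> [[t u] [<- <-]] /=; rewrite linearD linearN dd add0r.
    by rewrite /= fE subrr.
  + move=> [e1 e2]; have [u uE] : exists u, d i.+1 u = w.
      by apply/exS/eqP; rewrite -oppr_eq0 e2.
    have [t tE] : exists t, d i.+2 t = v + f i.+2 u.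
      by apply/exS; rewrite linearD fE uE.
    by exists (t, - u); rewrite /cone_d1 /cone_d0 /= tE !linearN opprK uE addrK.
  + move=> [[t u] [<- <-]] /=; rewrite /cone_d1 /cone_d0 /= !linearD !linearN /= dd add0r dd.
    by rewrite fE subrr oppr0; congr pair; rewrite oppr0.
Qed.

End Cone.

End Resolutions.

(** * Extension of scalars from [R] to [A] *)

Section Induction.

Variables (K : fieldType) (R A : algType K) (iota : {lrmorphism R -> A}).
Variables (gR : nat -> R -> Prop) (gA : nat -> A -> Prop).
Hypothesis gR_alg : graded_algebra gR.
Hypothesis gA_alg : graded_algebra gA.
Hypothesis iota_gr : forall p r, gR p r -> gA p (iota r).

Lemma iota_int_gr q r : int_gr gR q r -> int_gr gA q (iota r).
Proof. by case: q => [p|p] /=; [apply: iota_gr|move=> ->; rewrite rmorph0]. Qed.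

(* [ind_mod] is [A] tensored with the free module [M] over [R], and [ind_map]
   sends [v] to the tensor [1 (x) v]. *)
Record induced (M : lmodType R) (gM : int -> M -> Prop) := Induced {
  ind_index : eqType;
  ind_basis : ind_index -> M;
  ind_deg : ind_index -> int;
  ind_coord : ind_index -> M -> R;
  ind_mod : lmodType A;
  ind_map : M -> ind_mod;
  ind_mod_coord : ind_index -> ind_mod -> A;
  ind_basis_gr : forall y, gM (ind_deg y) (ind_basis y);
  ind_coordP : coordinates (fun y r => r *: ind_basis y) ind_coord;
  ind_coord_gr : forall q v y, gM q v -> int_gr gR (q - ind_deg y) (ind_coord y v);
  ind_mapB : forall u v, ind_map (u - v) = ind_map u - ind_map v;
  ind_mapZ : forall r v, ind_map (r *: v) = iota r *: ind_map v;
  ind_mod_coordP : coordinates (fun y a => a *: ind_map (ind_basis y)) ind_mod_coord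
}.

Arguments ind_deg {M gM} i y.
Arguments ind_map {M gM} i v.
Arguments ind_coordP {M gM} i.
Arguments ind_mod_coordP {M gM} i.

Lemma induced_exists (M : lmodType R) (gM : int -> M -> Prop) :
  graded_free gR gM -> exists c : induced gM, True.
Proof.
move=> /(graded_free_coord gR_alg)[X [e [deg [co [ge coP gco]]]]].
(* Finitely supported functions from [X] to [A]; [eclassic] supplies the choice structure on [X]
   that they require. *)
pose N : lmodType A := {malg A[{eclassic X}]}.
have [|j [jB j1]] := coords_ext coP
    (psi := fun y r => (<< iota r *g (y : {eclassic X}) >> : {malg A[{eclassic X}]})).
  by move=> y r t; rewrite rmorphB monalgUB.
have j0 := sub_morph0 jB; have jD := sub_morphD jB.
have jZ r v : j (r *: v) = (iota r : A) *: j v.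
  move: v; apply: (coords_ind coP) => [|u v hu hv|y t].
  - by rewrite scaler0 j0 scaler0.
  - by rewrite scalerDr !jD hu hv scalerDr.
  - rewrite scalerA !j1 rmorphM; apply/malgP => k.
    by rewrite mcoeffZ !mcoeffU; case: eqP => _; rewrite ?mulr0.
have jE y a : a *: j (e y) = << a *g (y : {eclassic X}) >>.
  rewrite -[e y]scale1r j1 rmorph1; apply/malgP => k.
  by rewrite mcoeffZ !mcoeffU; case: eqP => _; rewrite ?mulr0 ?mulr1.
suff jcoP : coordinates (fun y a => a *: (j (e y) : N))
    (fun (y : X) (v : N) => v@_(y : {eclassic X})).
  by exists (Induced ge coP gco (jB : forall u v, (j (u - v) : N) = j u - j v) jZ jcoP).
split.
- by move=> y u v; rewrite mcoeffB.
- move=> v; exists (msupp (v : {malg A[{eclassic X}]})); split; first exact: fset_uniq.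
    by move=> y h; apply/eqP; rewrite mcoeff_eq0; exact: h.
  by rewrite {1}[v]monalgE; apply: eq_bigr => y _; rewrite jE.
- move=> y a k; rewrite jE mcoeffU; case: eqP => [->|yk]; first by rewrite eqxx.
  by case: eqP yk => // ->.
Qed.

Section InducedTheory.

Variables (M : lmodType R) (gM : int -> M -> Prop) (N : induced gM).

Local Notation j := (ind_map N).

Definition ind_gr (q : int) (v : ind_mod N) : Prop :=
  forall y, int_gr gA (q - ind_deg N y) (ind_mod_coord y v).

Lemma ind_map0 : j 0 = 0.
Proof. exact: sub_morph0 (@ind_mapB _ _ N). Qed.

Lemma ind_mapD u v : j (u + v) = j u + j v.
Proof. exact: sub_morphD (@ind_mapB _ _ N) u v. Qed.

Lemma ind_map_sum (T : Type) (s : seq T) (P : pred T) F :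
  j (\sum_(t <- s | P t) F t) = \sum_(t <- s | P t) j (F t).
Proof. exact: (big_morph j ind_mapD ind_map0). Qed.

Lemma ind_mod_phiB (y : ind_index N) (a b : A) :
  (a - b) *: j (ind_basis y) = a *: j (ind_basis y) - b *: j (ind_basis y).
Proof. by rewrite scalerBl. Qed.

Lemma ind_mod_coordZ y a v : ind_mod_coord y (a *: v) = a * ind_mod_coord (i := N) y v.
Proof.
apply: (@coords_scale _ _ _ (fun a v => a *: v) _ _) (ind_mod_coordP N) _ _ _.
  by move=> ? ? ?; rewrite scalerDr.
by move=> ? ? ?; rewrite scalerA.
Qed.

Lemma ind_mod_coord_map y v : ind_mod_coord y (j v) = iota (ind_coord y v).
Proof.
have [coB _ co1] := ind_coordP N; have [_ _ co1'] := ind_mod_coordP N.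
move: v; apply: (coords_ind (ind_coordP N)) => [|u v hu hv|z r].
- by rewrite ind_map0 (coords0 (ind_mod_coordP N)) (coords0 (ind_coordP N)) rmorph0.
- by rewrite ind_mapD (coordsD (ind_mod_coordP N)) (coordsD (ind_coordP N)) hu hv rmorphD.
- by rewrite ind_mapZ co1' co1; case: eqP => _; rewrite ?rmorph0.
Qed.

Lemma ind_map_gr q v : gM q v -> ind_gr q (j v).
Proof. by move=> gv y; rewrite ind_mod_coord_map; apply/iota_int_gr/ind_coord_gr. Qed.

Lemma ind_graded_free : graded_free gA ind_gr.
Proof.
have [dA _ g1 _] := gA_alg.
split; first split.
- exact: (coord_direct_sum ind_mod_phiB (ind_mod_coordP N) _ (int_gr_direct_sum dA)).
- move=> p q b v gb gv y; rewrite ind_mod_coordZ -addrA.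
  exact: (int_gr_mul gA_alg (p := p)).
exists (ind_index N), (fun y => j (ind_basis y)), (ind_deg N); split.
  by move=> y; apply: ind_map_gr; apply: ind_basis_gr.
exact: coord_left_basis (ind_mod_coordP N).
Qed.

Lemma ind_generated q : generated_in_degree gM q -> generated_in_degree ind_gr q.
Proof.
move=> gen; apply: (coords_ind (ind_mod_coordP N)); [exact: in_span0|exact: in_span_add|].
move=> y a; have [s [hs ->]] := gen (ind_basis y).
rewrite ind_map_sum scaler_sumr big_seq.
apply: (big_ind (in_span (ind_gr q))); [exact: in_span0|exact: in_span_add|].
move=> cu /hs g; rewrite ind_mapZ scalerA; apply: in_span_scale.
exact: ind_map_gr.
Qed.

Section RightFree.

Variables (I : eqType) (m : I -> A).
Hypothesis m_span : forall (G : A -> Prop), G 0 ->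
  (forall a b, G a -> G b -> G (a + b)) ->
  (forall i r, G (m i * iota r)) -> forall a, G a.
Hypothesis m_free : forall (s : seq I) (c : I -> R), uniq s ->
  \sum_(i <- s) m i * iota (c i) = 0 -> forall i, i \in s -> c i = 0.

(** With [m] a right [R]-basis of [A], the induced module is the direct sum of the copies
    [m i *: j M]. This takes the place of flatness: exactness is checked in [M], one [i] at a
    time. *)
Definition ind_decomposes := @decomposes I M (ind_mod N) (fun _ _ => True)
  (fun i v => m i *: j v).

Lemma ind_decomposesP v : exists c, ind_decomposes v c.
Proof.
have phiB i u w : m i *: j (u - w) = m i *: j u - m i *: j w.
  by rewrite ind_mapB scalerBr.
move: v; apply: (coords_ind (ind_mod_coordP N)).
- by exists (fun=> 0); apply: decomposes0.
- move=> u v [c hc] [d hd]; exists (fun i => c i + d i).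
  by apply: decomposes_add hc hd.
move=> y; apply: m_span.
- by rewrite scale0r; exists (fun=> 0); apply: decomposes0.
- move=> a b [c hc] [d hd]; exists (fun i => c i + d i).
  by rewrite scalerDl; apply: decomposes_add hc hd.
move=> i r; rewrite -scalerA -ind_mapZ.
by eexists; apply: (@decomposes1 I M _ (fun _ _ => True) (fun i v => m i *: j v)).
Qed.

Lemma ind_free (s : seq I) (c : I -> M) : uniq s ->
  \sum_(i <- s) m i *: j (c i) = 0 -> forall i, i \in s -> c i = 0.
Proof.
move=> us c0 i si.
have phiB y (r t : R) : (r - t) *: ind_basis (i := N) y =
    r *: ind_basis y - t *: ind_basis y by rewrite scalerBl.
apply: (coords_inj0 phiB (ind_coordP N)) => y.
apply: (m_free (s := s) (c := fun i => ind_coord y (c i))) => //.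
rewrite -[RHS](coords0 (ind_mod_coordP N) y) -c0 (coords_sum (ind_mod_coordP N)).
by apply: eq_bigr => k _; rewrite ind_mod_coordZ ind_mod_coord_map.
Qed.

End RightFree.

End InducedTheory.

Variables (I : eqType) (m : I -> A).
Hypothesis m_span : forall (G : A -> Prop), G 0 ->
  (forall a b, G a -> G b -> G (a + b)) ->
  (forall i r, G (m i * iota r)) -> forall a, G a.
Hypothesis m_free : forall (s : seq I) (c : I -> R), uniq s ->
  \sum_(i <- s) m i * iota (c i) = 0 -> forall i, i \in s -> c i = 0.

Variable eps : {lrmorphism R -> K^o}.
Variable L : A -> Prop.
Hypothesis idL : left_ideal L.
Hypothesis L_eps : forall r, L (iota r - (eps r)%:A).
Hypothesis L_free : forall (s : seq I) (k : I -> K), uniq s ->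
  L (\sum_(i <- s) k i *: m i) -> forall i, i \in s -> k i = 0.

(** Modulo [L], [L_eps] rewrites [m i * iota r] as [eps r *: m i], and [L_free] says that nothing
    more collapses. So [A/L] has [K]-basis [m]: it is the trivial module induced to [A], and right
    freeness keeps the induced complex exact. *)
Lemma induced_resolution : (exists P gP d eta,
    @linear_free_resolution K R gR eps P gP d eta) ->
  has_linear_resolution gA L.
Proof.
move=> [P [gP [d [eta [gens gd [etaZ eta_gr eta_surj] ex0 exS]]]]].
have [L0 LD LM] := idL.
have fP i : graded_free gR (@gP i) by case: (gens i).
have mP i : graded_module gR (@gP i) by case: (fP i).
pose N i : induced (@gP i) := sval (cid (induced_exists (fP i))).
have mN i : graded_module gA (@ind_gr _ _ (N i)) by case: (ind_graded_free (N i)).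
pose D i : {linear ind_mod (N i.+1) -> ind_mod (N i)} :=
  sval (cid (linear_lift (fun y => ind_map (N i) (d i (ind_basis y)))
    (ind_mod_coordP (N i.+1)))).
have DE i (y : ind_index (N i.+1)) :
    D i (ind_map (N i.+1) (ind_basis y)) = ind_map (N i) (d i (ind_basis y)).
  by rewrite /D; case: cid => h hE /=; apply: hE.
have Dmap i v : D i (ind_map (N i.+1) v) = ind_map (N i) (d i v).
  move: v; apply: (coords_ind (ind_coordP (N i.+1))) => [|u v hu hv|y r].
  - by rewrite ind_map0 !raddf0 ind_map0.
  - by rewrite ind_mapD !linearD ind_mapD hu hv.
  - by rewrite ind_mapZ !linearZ /= ind_mapZ DE.
(* The values of [eta] are scalars, so they lift to [A] on the basis; on a general [ind_map (N 0) v]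
   the lift agrees with [eta v] only modulo [L]. *)
have [pi' piE] := linear_lift (N := A^o)
  (fun y : ind_index (N 0) => (eta (ind_basis y))%:A : A) (ind_mod_coordP (N 0)).
pose pi : {additive ind_mod (N 0) -> A} := pi'.
have piZ a v : pi (a *: v) = a * pi v by rewrite /pi /= linearZ.
have pi1 (y : ind_index (N 0)) :
    pi (ind_map (N 0) (ind_basis y)) = (eta (ind_basis y))%:A by exact: piE.
have pi_map v : L (pi (ind_map (N 0) v) - (eta v)%:A).
  move: v; apply: (coords_ind (ind_coordP (N 0))) => [|u v hu hv|y r].
  - by rewrite ind_map0 !raddf0 scale0r subrr.
  - by rewrite ind_mapD !raddfD /= scalerDl opprD addrACA; apply: LD.
  - rewrite ind_mapZ piZ pi1 etaZ -scalerAr mulr1 [eps r * _]mulrC.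
    rewrite -scalerA -scalerBr -[_ - _]mul1r scalerAl; apply: LM.
    exact: L_eps.
exists (fun i => ind_mod (N i)), (fun i => @ind_gr _ _ (N i)), D, pi; split.
- move=> i; split; first exact: ind_graded_free.
  by apply: ind_generated; case: (gens i).
- move=> i q v gv; have [_ coE _] := ind_mod_coordP (N i.+1).
  have [s [_ _ ->]] := coE v; rewrite linear_sum.
  apply: direct_sum_sum; first by case: (mN i).
  move=> y _; rewrite linearZ /= DE -[q](subrK (ind_deg (N i.+1) y)).
  apply: (graded_module_int (mN i)) (gv y) _.
  by apply: ind_map_gr; apply: gd; apply: ind_basis_gr.
- split=> //.
    move=> q v gv; have [_ coE _] := ind_mod_coordP (N 0).
    have [dA gAZ gA1 _] := gA_alg; have dA' := int_gr_direct_sum dA.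
    have [s [_ _ ->]] := coE v; rewrite raddf_sum.
    apply: direct_sum_sum => // y _; rewrite /= piZ pi1.
    rewrite -[q](subrK (ind_deg (N 0) y)); apply: (int_gr_mul gA_alg) (gv y) _.
    case: (eqVneq (ind_deg (N 0) y) 0) => [->|dy]; first exact: gAZ.
    by rewrite (eta_gr _ _ dy) ?scale0r; [case: dA'|apply: ind_basis_gr].
  have [u u1] := eta_surj 1; have [dP _] := mP 0%N.
  have [pr [pr1 _ pr3 _]] := direct_sum_proj dP.
  have [s [us s0 uE]] := pr3 u.
  (* The component of degree 0 of [u] still has [eta] equal to 1, since [eta] vanishes in all other
     degrees. *)
  exists (ind_map (N 0) (pr 0 u)); split; first exact/ind_map_gr/pr1.
  suff <- : (eta (pr 0 u))%:A = 1 :> A by apply: pi_map.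
  suff -> : eta (pr 0 u) = 1 by rewrite scale1r.
  rewrite -u1 [in RHS]uE raddf_sum; case: (boolP (0 \in s)) => h.
    rewrite (bigD1_seq 0) //= big1 ?addr0 // => q q0.
    exact: eta_gr q0 (pr1 _ _).
  rewrite (s0 _ h) raddf0 big1_seq // => q /andP[_ qs].
  by apply: eta_gr (pr1 q u); apply: contraNneq h => <-.
- move=> v; split=> [Lv|[w <-]].
    have [c [_ [s [us c0 vE]]]] := ind_decomposesP m_span v.
    (* Modulo [L], [pi v] is the sum of the [eta (c i) *: m i], so [L_free] kills each coefficient,
       and exactness over [R] lifts each [c i] separately. *)
    have eta0 i : i \in s -> eta (c i) = 0.
      apply: (L_free (k := fun i => eta (c i))) => //.
      have -> : \sum_(i <- s) eta (c i) *: m i = pi v -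
          \sum_(i <- s) m i * (pi (ind_map (N 0) (c i)) - (eta (c i))%:A).
        rewrite vE raddf_sum -sumrB; apply: eq_bigr => k _.
        by rewrite /= piZ mulrBr subKr -scalerAr mulr1.
      apply: (LD) => //; rewrite -mulN1r; apply: (LM).
      by apply: (big_ind L) => // k _; apply: LM.
    have /choice[b bE] : forall i, exists w, d 0 w = c i.
      by move=> i; apply/ex0; case: (boolP (i \in s)) => [/eta0|/c0 ->]; rewrite ?raddf0.
    exists (\sum_(i <- s) m i *: ind_map (N 1) (b i)).
    by rewrite linear_sum vE; apply: eq_bigr => i _; rewrite linearZ /= Dmap bE.
  move: w; apply: (coords_ind (ind_mod_coordP (N 1))) => [|u w hu hw|y a].
  - by rewrite !raddf0.
  - by rewrite linearD raddfD; apply: LD.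
  - rewrite linearZ /= piZ DE; apply: (LM); rewrite -[pi _]subr0.
    have e0 : eta (d 0 (ind_basis y)) = 0 by apply/ex0; exists (ind_basis y).
    by have := pi_map (d 0 (ind_basis y)); rewrite e0 scale0r.
- move=> i v; split=> [Dv|[w <-]].
    have [c [_ [s [us c0 vE]]]] := ind_decomposesP m_span v.
    have d0 k : k \in s -> d i (c k) = 0.
      apply: (ind_free (N := N i) m_free (c := fun k => d i (c k))) => //.
      rewrite -[RHS]Dv vE linear_sum.
      by apply: eq_bigr => l _; rewrite linearZ /= Dmap.
    have /choice[b bE] : forall k, exists w, d i.+1 w = c k.
      by move=> k; apply/exS; case: (boolP (k \in s)) => [/d0|/c0 ->]; rewrite ?raddf0.
    exists (\sum_(k <- s) m k *: ind_map (N i.+2) (b k)).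
    by rewrite linear_sum vE; apply: eq_bigr => k _; rewrite linearZ /= Dmap bE.
  move: w; apply: (coords_ind (ind_mod_coordP (N i.+2))) => [|u w hu hw|y a].
  - by rewrite !raddf0.
  - by rewrite !linearD hu hw addr0.
  - rewrite !linearZ /= DE Dmap; have -> : d i (d i.+1 (ind_basis y)) = 0.
      by apply/exS; exists (ind_basis y).
    by rewrite ind_map0 scaler0.
Qed.

End Induction.

(** * Reordering of words and the grading of a skew PBW extension *)

Section SkewPBWTheory.

Variables (K : fieldType) (R A : algType K) (gR : nat -> R -> Prop).
Variables (iota : {lrmorphism R -> A}) (n : nat) (x : 'I_n -> A).
Variables (sigma : 'I_n -> {rmorphism R -> R}) (delta : 'I_n -> R -> R).
Variable c : 'I_n -> 'I_n -> R.

Hypothesis gR_alg : graded_algebra gR.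
Hypothesis gR_conn : connected gR.
Hypothesis basisA : left_basis (fun r (a : A) => iota r * a) (smon x).
Hypothesis commA : forall i r, x i * iota r = iota (sigma i r) * x i + iota (delta i r).
Hypothesis sigma_bij : forall i, bijective (sigma i).
Hypothesis c_inv : forall i j : 'I_n, (i < j)%N ->
  exists u, u * c i j = 1 /\ c i j * u = 1.
Hypothesis x1 : forall i, skew_grading iota x gR 1 (x i).
Hypothesis sd_gr : forall i p r, gR p r -> gR p (sigma i r) /\ gR p.+1 (delta i r).
Hypothesis relA : forall i j, gR 0 (c i j) /\
  in_affine_span iota x (gR 2) (gR 1) (x j * x i - iota (c i j) * x i * x j).

Implicit Types (w u : seq 'I_n) (a b : A) (r : R).
Notation mono := {ffun 'I_n -> nat}.
Implicit Types alpha beta gamma : mono.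

Definition mono_deg (alpha : mono) : nat := (\sum_i alpha i)%N.

Definition word w : A := \prod_(i <- w) x i.

Definition word_count w : mono := [ffun i => count_mem i w].

Definition mono_word (alpha : mono) : seq 'I_n :=
  flatten [seq nseq (alpha i) i | i <- index_enum 'I_n].

Lemma word_cons i w : word (i :: w) = x i * word w.
Proof. by rewrite /word big_cons. Qed.

Lemma word_cat u w : word (u ++ w) = word u * word w.
Proof. by rewrite /word big_cat. Qed.

Lemma smon_word alpha : smon x alpha = word (mono_word alpha).
Proof.
rewrite /smon /word /mono_word big_flatten big_map /=.
apply: eq_bigr => i _; elim: (alpha i) => [|k IH]; first by rewrite big_nil.
by rewrite exprS big_cons IH.
Qed.

Lemma mono_word_count alpha i : count_mem i (mono_word alpha) = alpha i.
Proof.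
rewrite /mono_word count_flatten -map_comp sumnE big_map /=.
rewrite (bigD1 i) //= count_nseq /= eqxx mul1n big1 ?addn0 // => j /negPf ji.
by rewrite count_nseq /= ji.
Qed.

Lemma size_mono_word alpha : size (mono_word alpha) = mono_deg alpha.
Proof.
rewrite size_flatten /shape -map_comp sumnE big_map /=.
by apply: eq_bigr => i _; rewrite size_nseq.
Qed.

Lemma perm_mono_word w : perm_eq w (mono_word (word_count w)).
Proof. by apply/allP => i _; rewrite /= mono_word_count ffunE. Qed.

Lemma mono_deg_count w : mono_deg (word_count w) = size w.
Proof. by rewrite -size_mono_word -(perm_size (perm_mono_word w)). Qed.

Lemma gR_sum : direct_sum gR. Proof. by case: gR_alg. Qed.

Lemma gR1 : gR 0 1. Proof. by case: gR_alg. Qed.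

Lemma gRZ p (k : K) r : gR p r -> gR p (k *: r).
Proof. by case: gR_alg => _ h _ _; apply: h. Qed.

(* Spans of [iota r * word w], where [w] need not be sorted. *)
Definition word_span (Q : R -> seq 'I_n -> Prop) (a : A) : Prop :=
  exists2 s : seq (R * seq 'I_n), forall rw, rw \in s -> Q rw.1 rw.2
    & a = \sum_(rw <- s) iota rw.1 * word rw.2.

Lemma word_span_ind Q (G : A -> Prop) : G 0 ->
  (forall a b, G a -> G b -> G (a + b)) ->
  (forall r w, Q r w -> G (iota r * word w)) ->
  forall a, word_span Q a -> G a.
Proof.
move=> G0 GD Gw _ [s Qs ->]; elim: s Qs => [|rw s IH] Qs; first by rewrite big_nil.
rewrite big_cons; apply: GD; first by apply/Gw/Qs; rewrite inE eqxx.
by apply: IH => rw' s'; apply: Qs; rewrite inE s' orbT.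
Qed.

Lemma word_span0 Q : word_span Q 0.
Proof. by exists [::]; rewrite ?big_nil. Qed.

Lemma word_spanD Q a b : word_span Q a -> word_span Q b -> word_span Q (a + b).
Proof.
move=> [s Qs ->] [t Qt ->]; exists (s ++ t); last by rewrite big_cat.
by move=> rw; rewrite mem_cat => /orP[/Qs|/Qt].
Qed.

Lemma word_span1 (Q : R -> seq 'I_n -> Prop) r w :
  Q r w -> word_span Q (iota r * word w).
Proof.
move=> Qrw; exists [:: (r, w)]; last by rewrite big_seq1.
by move=> rw; rewrite inE => /eqP ->.
Qed.

Lemma word_span_mulx (Q Q' : R -> seq 'I_n -> Prop) i a :
    (forall r w, Q r w -> Q' (sigma i r) (i :: w) /\ Q' (delta i r) w) ->
  word_span Q a -> word_span Q' (x i * a).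
Proof.
move=> QQ; move: a; apply: word_span_ind => [|a b ha hb|r w /QQ[h1 h2]].
- by rewrite mulr0; apply: word_span0.
- by rewrite mulrDr; apply: word_spanD.
- rewrite mulrA commA mulrDl -mulrA -word_cons.
  by apply: word_spanD; apply: word_span1.
Qed.

Lemma word_span_mull (Q Q' : R -> seq 'I_n -> Prop) r a :
    (forall t w, Q t w -> Q' (r * t) w) ->
  word_span Q a -> word_span Q' (iota r * a).
Proof.
move=> QQ; move: a; apply: word_span_ind => [|a b ha hb|t w /QQ h1].
- by rewrite mulr0; apply: word_span0.
- by rewrite mulrDr; apply: word_spanD.
- by rewrite mulrA -rmorphM; apply: word_span1.
Qed.

Lemma word_span_mulr (Q Q' : R -> seq 'I_n -> Prop) u a :
    (forall r w, Q r w -> Q' r (w ++ u)) ->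
  word_span Q a -> word_span Q' (a * word u).
Proof.
move=> QQ; move: a; apply: word_span_ind => [|a b ha hb|t w /QQ h1].
- by rewrite mul0r; apply: word_span0.
- by rewrite mulrDl; apply: word_spanD.
- by rewrite -mulrA -word_cat; apply: word_span1.
Qed.

(** The error terms of reordering. The condition [0 < t] works twice: the augmentation kills the
    coefficients, and the words are shorter than [d], which allows induction on length. *)
Definition low d := word_span (fun r w => exists t,
  [/\ (0 < t)%N, (t + size w)%N = d & gR t r]).

Lemma lowZ d (k : K) a : low d a -> low d (k *: a).
Proof.
have -> : k *: a = iota (k%:A) * a by rewrite linearZ rmorph1 /= -scalerAl mul1r.
apply: word_span_mull => r w [t [t0 tw gr]]; exists t; split=> //.
by rewrite -scalerAl mul1r; apply: gRZ.
Qed.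

(** Moving [x i] past a coefficient either applies [sigma i] and lengthens the word, or applies
    [delta i] and raises the coefficient degree. *)
Lemma low_mulx d i a : low d a -> low d.+1 (x i * a).
Proof.
apply: word_span_mulx => r w [t [t0 tw gr]]; have [g1 g2] := sd_gr i gr; split.
  by exists t; rewrite /= addnS tw.
by exists t.+1; rewrite addSn tw.
Qed.

Lemma low_mulw d u a : low d a -> low (size u + d) (word u * a).
Proof.
move=> la; elim: u => [|i u IH]; first by rewrite /word big_nil mul1r.
by rewrite word_cons -mulrA; apply: low_mulx.
Qed.

Lemma low_wmul d u a : low d a -> low (d + size u) (a * word u).
Proof.
by apply: word_span_mulr => r w [t [t0 <- gr]]; exists t; rewrite size_cat addnA.
Qed.

Definition word_rel w u : Prop :=
  size w = size u /\ exists2 k : K, k != 0 & low (size w) (word w - k *: word u).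

Lemma word_rel_refl w : word_rel w w.
Proof.
by split=> //; exists 1; rewrite ?oner_eq0 // scale1r subrr; apply: word_span0.
Qed.

Lemma word_rel_trans w u v : word_rel w u -> word_rel u v -> word_rel w v.
Proof.
move=> [s1 [k k0 h1]] [s2 [l l0 h2]]; split; first by rewrite s1.
exists (k * l); first by rewrite mulf_neq0.
rewrite -[word w](subrK (k *: word u)) -addrA -scalerA -scalerBr.
by apply: word_spanD => //; apply: lowZ; rewrite s1.
Qed.

Lemma word_rel_cat v v' w u : word_rel w u -> word_rel (v ++ w ++ v') (v ++ u ++ v').
Proof.
move=> [s1 [k k0 h]]; split; first by rewrite !size_cat s1.
exists k => //; rewrite !word_cat scalerAr -mulrBr scalerAl -mulrBl.
by rewrite !size_cat; apply/low_mulw/low_wmul.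
Qed.

(** For increasing indices the coefficient [c] lies in [R_0 = K] and is invertible, hence is a
    nonzero scalar; the opposite order uses its inverse. The affine remainder has coefficients of
    degree 2 and 1, so it is in [low 2]. *)
Lemma word_rel_swap i j : word_rel [:: i; j] [:: j; i].
Proof.
have key (i' j' : 'I_n) : (i' < j')%N -> exists2 k : K, k != 0 &
    low 2 (word [:: j'; i'] - k *: word [:: i'; j']).
  move=> ij; have [/gR_conn[k ck] [r0 [r [g2 g1 e]]]] := relA i' j'.
  exists k.
    apply/eqP => k0; have [v [+ _]] := c_inv ij.
    by rewrite ck k0 scale0r mulr0 => /esym/eqP; rewrite oner_eq0.
  have -> : k *: word [:: i'; j'] = iota (c i' j') * x i' * x j'.
    by rewrite ck linearZ rmorph1 /= -!scalerAl mul1r /word !big_cons big_nil mulr1.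
  rewrite [word _](_ : _ = x j' * x i'); last by rewrite /word !big_cons big_nil mulr1.
  rewrite e; apply: word_spanD.
    rewrite -[iota r0]mulr1 -[1](_ : word [::] = _); last by rewrite /word big_nil.
    by apply: word_span1; exists 2.
  apply: (big_ind (low 2)) => [||m _]; [exact: word_span0|exact: word_spanD|].
  rewrite -[x m](_ : word [:: m] = _); last by rewrite /word big_seq1.
  by apply: word_span1; exists 1.
case: (ltngtP i j) => [ij|ji|/val_inj ->]; last exact: word_rel_refl.
  have [k k0 lk] := key _ _ ij; split=> //; exists k^-1; first by rewrite invr_eq0.
  rewrite -[word _](scalerK k0) -scalerBr; apply: lowZ.
  by rewrite -opprB -scaleN1r; apply: lowZ.
by have [k k0 lk] := key _ _ ji; split=> //; exists k.
Qed.

Lemma word_rel_move i u : word_rel (i :: u) (u ++ [:: i]).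
Proof.
elim: u => [|j u IH]; first exact: word_rel_refl.
apply: word_rel_trans (word_rel_cat [::] u (word_rel_swap i j)) _.
by have := word_rel_cat [:: j] [::] IH; rewrite !cats0.
Qed.

Lemma word_rel_perm w u : perm_eq w u -> word_rel w u.
Proof.
elim: w u => [|i w IH] u.
  by rewrite perm_sym => /perm_nilP ->; apply: word_rel_refl.
move=> pu; have iu : i \in u by rewrite -(perm_mem pu) inE eqxx.
case/splitPr: iu pu => p q pq.
have /IH h : perm_eq w (p ++ q) by rewrite -(perm_cons i) (perm_trans pq) // perm_catC
  /= perm_cons perm_catC.
have := word_rel_cat [:: i] [::] h; rewrite !cats0 /= => /word_rel_trans; apply.
have := word_rel_cat [::] q (word_rel_move i p).
by rewrite /= -catA /=.
Qed.

Lemma word_mono w : exists2 k : K, k != 0 &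
  low (size w) (word w - k *: smon x (word_count w)).
Proof.
by rewrite smon_word; have [_] := word_rel_perm (perm_mono_word w).
Qed.

Variable co : mono -> A -> R.
Hypothesis coP : coordinates (fun alpha r => iota r * smon x alpha) co.

Lemma co_phiB alpha r t :
  iota (r - t) * smon x alpha = iota r * smon x alpha - iota t * smon x alpha.
Proof. by rewrite rmorphB mulrBl. Qed.

Lemma co_mull alpha r a : co alpha (iota r * a) = r * co alpha a.
Proof.
apply: (@coords_scale _ _ _ (fun r a => iota r * a) _ co) coP _ _ _.
  by move=> ? ? ?; rewrite mulrDr.
by move=> ? ? ?; rewrite mulrA rmorphM.
Qed.

Lemma co_smon alpha beta : co alpha (smon x beta) = (alpha == beta)%:R.
Proof.
case: coP => _ _ /(_ beta 1 alpha).
by rewrite rmorph1 mul1r => ->; case: eqP.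
Qed.

Lemma coZ alpha (k : K) a : co alpha (k *: a) = k *: co alpha a.
Proof.
have -> : k *: a = iota (k%:A) * a by rewrite linearZ rmorph1 /= -scalerAl mul1r.
by rewrite co_mull -scalerAl mul1r.
Qed.

Lemma coB alpha a b : co alpha (a - b) = co alpha a - co alpha b.
Proof. by case: coP => h _ _; apply: h. Qed.

(** The grading read off coordinates. That it is a direct sum is then formal, from the freeness of
    [A]; multiplicativity is what needs the reordering of words. *)
Definition int_skew_grading (q : int) (a : A) : Prop :=
  forall alpha, int_gr gR (q - (mono_deg alpha)%:Z) (co alpha a).

Lemma int_skew_direct_sum : direct_sum int_skew_grading.
Proof.
by apply: (coord_direct_sum co_phiB coP _ (int_gr_direct_sum gR_sum)).
Qed.

Lemma int_skew_mull t (q : int) r a :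
  gR t r -> int_skew_grading q a -> int_skew_grading (t%:Z + q) (iota r * a).
Proof.
move=> gr ga alpha; rewrite co_mull -addrA.
exact: (int_gr_mul gR_alg (p := t)).
Qed.

Lemma int_skew_smon alpha : int_skew_grading (mono_deg alpha)%:Z (smon x alpha).
Proof.
move=> beta; rewrite co_smon; case: eqP => [->|_]; first by rewrite subrr; apply: gR1.
by have [h _ _ _] := int_gr_direct_sum gR_sum; apply: h.
Qed.

Lemma int_skewD q a b :
  int_skew_grading q a -> int_skew_grading q b -> int_skew_grading q (a + b).
Proof. exact: direct_sumD int_skew_direct_sum. Qed.

Lemma int_skewZ q (k : K) a : int_skew_grading q a -> int_skew_grading q (k *: a).
Proof.
have -> : k *: a = iota (k%:A) * a by rewrite linearZ rmorph1 /= -scalerAl mul1r.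
by move=> ga; rewrite -[q]add0r; apply: int_skew_mull => //; apply/gRZ/gR1.
Qed.

Lemma int_skew0 q : int_skew_grading q 0.
Proof. by have [h _ _ _] := int_skew_direct_sum; apply: h. Qed.

(** By induction on length: sorting gives a multiple of a standard monomial plus [low] terms, whose
    words are shorter. *)
Lemma int_skew_word w : int_skew_grading (size w)%:Z (word w).
Proof.
have [m] := ubnP (size w); elim: m w => // m IH w /ltnSE wm.
have [k _ lk] := word_mono w; rewrite -[word w](subrK (k *: smon x (word_count w))).
apply: int_skewD; last by apply: int_skewZ; rewrite -mono_deg_count; apply: int_skew_smon.
move: lk; apply: word_span_ind => [||r u [t [t0 tw gr]]].
- exact: int_skew0.
- exact: int_skewD.
- rewrite -tw PoszD; apply: int_skew_mull => //; apply: IH.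
  by apply: leq_trans wm; rewrite -tw -{1}[size u]add0n ltn_add2r.
Qed.

Lemma int_skew_ind p (G : A -> Prop) : G 0 -> (forall a b, G a -> G b -> G (a + b)) ->
    (forall t r alpha, gR t r -> (t + mono_deg alpha)%N = p ->
      G (iota r * smon x alpha)) ->
  forall a, int_skew_grading p%:Z a -> G a.
Proof.
move=> G0 GD G1 a ga; have [_ coE _] := coP; have [s [_ _ ->]] := coE a.
apply: (big_ind G) => // alpha _; move: (ga alpha).
case: (leqP (mono_deg alpha) p) => [le|lt].
  rewrite subzn // => gr; apply: G1 gr _; exact: subnK.
(* At a monomial of degree above [p] the coordinate has negative degree, so it vanishes. *)
have [k ->] : exists k, p%:Z - (mono_deg alpha)%:Z = Negz k.
  exists (mono_deg alpha - p).-1; rewrite NegzE prednK ?subn_gt0 //.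
  by rewrite -subzn 1?ltnW // opprB.
by move=> /= ->; rewrite rmorph0 mul0r.
Qed.

Lemma skew_gradingP p a : skew_grading iota x gR p a <-> int_skew_grading p%:Z a.
Proof.
split.
  move=> [s [hs ->]]; elim: s hs => [|cu s IH] hs.
    by rewrite big_nil; apply: int_skew0.
  rewrite big_cons; apply: int_skewD; last first.
    by apply: IH => v vs; apply: hs; rewrite inE vs orbT.
  have [|t [r [alpha [gr <- ->]]]] := hs cu; first by rewrite inE eqxx.
  by apply: int_skewZ; rewrite PoszD; apply: int_skew_mull => //; apply: int_skew_smon.
move: a; apply: int_skew_ind; [exact: in_span0 | exact: in_span_add |].
move=> t r alpha gr tp; rewrite -[iota r * _]scale1r; apply: in_span_scale.
by exists t, r, alpha.
Qed.

Lemma int_skew_mulx (p : nat) i a :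
  int_skew_grading p%:Z a -> int_skew_grading p.+1%:Z (x i * a).
Proof.
move: a; apply: int_skew_ind => [|a b ga gb|t r alpha gr <-].
- by rewrite mulr0; apply: int_skew0.
- by rewrite mulrDr; apply: int_skewD.
have [g1 g2] := sd_gr i gr.
rewrite mulrA commA mulrDl -mulrA smon_word -word_cons; apply: int_skewD.
  rewrite -addnS PoszD -size_mono_word; apply: int_skew_mull => //.
  exact: (int_skew_word (_ :: _)).
by rewrite -addSn PoszD -size_mono_word; apply: int_skew_mull => //; apply: int_skew_word.
Qed.

Lemma int_skew_mul (p q : nat) a b : int_skew_grading p%:Z a ->
  int_skew_grading q%:Z b -> int_skew_grading (p + q)%N%:Z (a * b).
Proof.
move=> + gb; move: a; apply: int_skew_ind => [|a a' ga ga'|t r alpha gr <-].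
- by rewrite mul0r; apply: int_skew0.
- by rewrite mulrDl; apply: int_skewD.
rewrite -mulrA -addnA PoszD; apply: int_skew_mull => //.
rewrite -size_mono_word smon_word; elim: (mono_word alpha) => [|i w IH].
  by rewrite /word big_nil mul1r.
by rewrite word_cons -mulrA /= addSn; apply: int_skew_mulx.
Qed.

Lemma skew_graded_algebra : graded_algebra (skew_grading iota x gR).
Proof.
have -> : skew_grading iota x gR = fun p => int_skew_grading p%:Z.
  by apply: funext => p; apply: funext => a; apply/propext/skew_gradingP.
split.
- apply: nat_direct_sum int_skew_direct_sum _ => p a ga.
  apply: (coords_inj0 co_phiB coP) => alpha; move: (ga alpha).
  by rewrite !NegzE -opprD -PoszD addSn -NegzE.
- by move=> p k a; apply: int_skewZ.
- by have := int_skew_word [::]; rewrite /word big_nil.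
- exact: int_skew_mul.
Qed.

Lemma mono_deg0 alpha : mono_deg alpha = 0 -> smon x alpha = 1.
Proof.
by rewrite -size_mono_word smon_word => /size0nil ->; rewrite /word big_nil.
Qed.

Lemma skew_connected : connected (skew_grading iota x gR).
Proof.
have [_ gZ g1 _] := skew_graded_algebra.
move=> a; split=> [/skew_gradingP|[k ->]]; last exact: gZ.
move: a; apply: int_skew_ind => [|a b [k ->] [l ->]|t r alpha gr /eqP].
- by exists 0; rewrite scale0r.
- by exists (k + l); rewrite scalerDl.
rewrite addn_eq0 => /andP[/eqP t0 /eqP /mono_deg0 ->].
move: gr; rewrite t0 => /gR_conn[k ->].
by exists k; rewrite mulr1 linearZ rmorph1.
Qed.

Lemma skew_locally_finite : locally_finite gR ->
  locally_finite (skew_grading iota x gR).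
Proof.
move=> /choice[S SP] p.
(* The exponents in a monomial of degree at most [p] are at most [p], so there are finitely many
   candidates; the filter below discards those for which the subtraction would truncate. *)
pose mo (f : {ffun 'I_n -> 'I_p.+1}) : mono := [ffun i => val (f i)].
pose s := flatten [seq [seq iota r * smon x (mo f) | r <- S (p - mono_deg (mo f))%N] |
  f <- enum {ffun 'I_n -> 'I_p.+1} & (mono_deg (mo f) <= p)%N].
exists s => b; split.
  move=> /skew_gradingP; move: b; apply: int_skew_ind.
  - exact: in_span0.
  - exact: in_span_add.
  move=> t r alpha gr tp.
  have [u [us ->]] := (SP t r).1 gr.
  rewrite linear_sum mulr_suml big_seq.
  apply: (big_ind (in_span (fun v => v \in s))); [exact: in_span0|exact: in_span_add|].
  move=> cu /us cuS; rewrite linearZ /= -scalerAl; apply: in_span_scale.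
  pose f : {ffun 'I_n -> 'I_p.+1} := [ffun i => inord (alpha i)].
  have moE : mo f = alpha.
    apply/ffunP => i; rewrite !ffunE /= inordK // ltnS -tp.
    by rewrite /mono_deg (bigD1 i) //= addnCA leq_addr.
  apply/flattenP; exists [seq iota r * smon x (mo f) | r <- S (p - mono_deg (mo f))%N].
    by apply: map_f; rewrite mem_filter mem_enum andbT moE -tp leq_addl.
  by rewrite moE -tp addnK; apply: (map_f (fun r => iota r * smon x alpha)).
have [dA gZ _ _] := skew_graded_algebra.
move=> [u [us ->]]; rewrite big_seq; apply: direct_sum_sum => // cu /us cus.
apply: gZ; case/flattenP: cus => _ /mapP[f + ->] /mapP[r rS ->].
rewrite mem_filter => /andP[fp _]; apply/skew_gradingP.
rewrite -(subnK fp) PoszD; apply: int_skew_mull; last exact: int_skew_smon.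
apply/SP; exists [:: (1, r)]; rewrite big_seq1 scale1r; split=> // z.
by rewrite inE => /eqP ->.
Qed.

(** * The quantum polynomial ring and its chain of ideals *)

Section Augmentation.

Variable eps : {lrmorphism R -> K^o}.
Hypothesis epsP : augmentation gR eps.

Lemma eps_scalar (k : K) : eps k%:A = k.
Proof. by rewrite linearZ rmorph1; apply: mulr1. Qed.

(** [eps] is injective on [R_0 = K], so an element of its kernel has no component of degree 0: the
    kernel is [R_+]. *)
Lemma eps_ker_ind (G : R -> Prop) : G 0 -> (forall r t, G r -> G t -> G (r + t)) ->
  (forall p r, (0 < p)%N -> gR p r -> G r) -> forall r, eps r = 0 -> G r.
Proof.
move=> G0 GD Gp r er; have [pr [pr1 prB pr3 _]] := direct_sum_proj gR_sum.
have [s [us s0 rE]] := pr3 r.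
have eR : eps r = eps (pr 0 r).
  rewrite {1}rE raddf_sum; case: (boolP (0%N \in s)) => h.
    rewrite (bigD1_seq 0%N) //= big1 ?addr0 // => p; rewrite -lt0n => p0.
    exact: epsP p0 (pr1 _ _).
  rewrite (s0 _ h) raddf0 big1_seq // => p /andP[_ ps].
  by apply: epsP (pr1 p r); rewrite lt0n; apply: contraNneq h => <-.
have p0 : pr 0 r = 0.
  have /gR_conn[k ek] := pr1 0%N r.
  by move: eR; rewrite ek eps_scalar er => <-; rewrite scale0r.
rewrite rE; apply: (big_ind G) => // -[|p] _; first by rewrite p0.
exact: Gp (pr1 _ _).
Qed.

Lemma eps_sigma i r : eps r = 0 -> eps (sigma i r) = 0.
Proof.
move: r; apply: eps_ker_ind => [|r t|p r p0 gr]; first by rewrite !rmorph0.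
  by rewrite rmorphD raddfD /= => -> ->; rewrite addr0.
by apply: epsP p0 _; case: (sd_gr i gr).
Qed.

(** Compare the coordinates at the trivial monomial in two expansions of [x i * iota (r + t)]. *)
Lemma delta_add i r t : delta i (r + t) = delta i r + delta i t.
Proof.
have := commA i (r + t); rewrite raddfD mulrDr !commA raddfD /= raddfD mulrDl /=.
rewrite addrACA => /addrI /(congr1 (co [ffun=> 0%N])).
have c0 t' : co [ffun=> 0%N] (iota t') = t'.
  rewrite -[iota t']mulr1 -[1](@mono_deg0 [ffun=> 0%N]).
    by rewrite co_mull co_smon eqxx mulr1.
  by rewrite /mono_deg big1 // => j _; rewrite ffunE.
by rewrite (coordsD coP) !c0.
Qed.

(** [delta i] raises degrees by one, so all its values lie in [R_+]. *)
Lemma eps_delta i r : eps (delta i r) = 0.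
Proof.
have [_ _ sp _] := gR_sum; have [s [d [gd ->]]] := sp r.
have d0 : delta i 0 = 0 by apply: (addrI (delta i 0)); rewrite -delta_add !addr0.
apply: (big_ind (fun r => eps (delta i r) = 0)).
- by rewrite d0 raddf0.
- by move=> t t' ht ht'; rewrite delta_add raddfD /= ht ht' addr0.
- move=> p _; apply: (epsP (p := p.+1)) => //.
  by case: (sd_gr i (gd p)).
Qed.

Definition scoord (alpha : mono) (a : A) : K := eps (co alpha a).

Lemma scoordB alpha a b : scoord alpha (a - b) = scoord alpha a - scoord alpha b.
Proof. by rewrite /scoord coB raddfB. Qed.

Lemma scoordD alpha a b : scoord alpha (a + b) = scoord alpha a + scoord alpha b.
Proof. by rewrite /scoord (coordsD coP) raddfD. Qed.

Lemma scoord0 alpha : scoord alpha 0 = 0.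
Proof. by rewrite /scoord (coords0 coP) raddf0. Qed.

Lemma scoord_mull alpha r a : scoord alpha (iota r * a) = eps r * scoord alpha a.
Proof. by rewrite /scoord co_mull rmorphM. Qed.

Lemma scoordZ alpha (k : K) a : scoord alpha (k *: a) = k * scoord alpha a.
Proof. by rewrite /scoord coZ linearZ. Qed.

Lemma scoord_smon alpha beta : scoord alpha (smon x beta) = (alpha == beta)%:R.
Proof. by rewrite /scoord co_smon rmorph_nat. Qed.

Lemma scoord_low alpha d a : low d a -> scoord alpha a = 0.
Proof.
move: a; apply: word_span_ind => [|a b ha hb|r w [t [t0 _ gr]]].
- exact: scoord0.
- by rewrite scoordD ha hb addr0.
- by rewrite scoord_mull (epsP t0 gr) mul0r.
Qed.

(** The [low] error of sorting is invisible to [scoord]; only the nonzero reordering scalar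
    remains. *)
Lemma scoord_word w : exists2 k : K, k != 0 &
  forall alpha, scoord alpha (word w) = k * (alpha == word_count w)%:R.
Proof.
have [k k0 lk] := word_mono w; exists k => // alpha.
rewrite -[word w](subrK (k *: smon x (word_count w))) scoordD (scoord_low _ lk).
by rewrite add0r scoordZ scoord_smon.
Qed.

Definition mono_incr (i : 'I_n) (alpha : mono) : mono := [ffun j => ((i == j) + alpha j)%N].

Lemma word_count_cons i alpha :
  word_count (i :: mono_word alpha) = mono_incr i alpha.
Proof. by apply/ffunP => j; rewrite !ffunE /= mono_word_count. Qed.

Lemma word_count_rcons i alpha :
  word_count (mono_word alpha ++ [:: i]) = mono_incr i alpha.
Proof.
by apply/ffunP => j; rewrite !ffunE count_cat /= mono_word_count addn0 addnC.
Qed.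

Lemma mono_incr_inj i : injective (mono_incr i).
Proof.
by move=> alpha beta /ffunP e; apply/ffunP => j; have := e j; rewrite !ffunE => /addnI.
Qed.

Lemma mono_incrP i alpha : (0 < alpha i)%N -> exists beta, alpha = mono_incr i beta.
Proof.
move=> ai; exists [ffun j => (alpha j - (i == j))%N].
by apply/ffunP => j; rewrite !ffunE; case: eqP => [<-|_]; rewrite ?subn0 ?subnKC.
Qed.

Lemma scoord_smon_mulr i alpha : exists2 k : K, k != 0 &
  forall beta, scoord beta (smon x alpha * x i) = k * (beta == mono_incr i alpha)%:R.
Proof.
have [k k0 e] := scoord_word (mono_word alpha ++ [:: i]); exists k => // beta.
by rewrite -word_count_rcons -e word_cat smon_word /word big_seq1.
Qed.

(* Modulo [iota R_+ * A] the algebra [A] is a quantum polynomial ring with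
   coordinates [scoord]; [sideal m] is its ideal generated by the first [m]
   variables, pulled back to [A]. *)
Definition sideal (m : nat) (a : A) : Prop :=
  forall alpha, (forall i : 'I_n, (i < m)%N -> alpha i = 0) -> scoord alpha a = 0.

Lemma sideal0 m : sideal m 0.
Proof. by move=> alpha _; apply: scoord0. Qed.

Lemma sidealD m a b : sideal m a -> sideal m b -> sideal m (a + b).
Proof. by move=> ha hb alpha h; rewrite scoordD ha ?hb ?addr0. Qed.

Lemma sideal_mull m r a : sideal m a -> sideal m (iota r * a).
Proof. by move=> ha alpha h; rewrite scoord_mull ha ?mulr0. Qed.

(** When [x i] passes a coefficient, the [delta i] term dies under [eps], and [sigma i] preserves
    the kernel of [eps]. If the resulting monomial avoids the first [m] variables, so does the one
    it comes from. *)
Lemma sideal_mulx m i a : sideal m a -> sideal m (x i * a).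
Proof.
move=> ha; have [_ coE _] := coP; have [s [_ _ aE]] := coE a.
rewrite aE mulr_sumr; apply: (big_ind (sideal m)); [exact: sideal0|exact: sidealD|].
move=> beta _ alpha alphaP.
rewrite mulrA commA mulrDl -mulrA scoordD !scoord_mull eps_delta mul0r addr0.
have [k k0 e] := scoord_word (i :: mono_word beta).
rewrite smon_word -word_cons e word_count_cons.
case: eqP => [ab|_]; last by rewrite !mulr0.
have b0 : scoord beta a = 0.
  apply: ha => j /alphaP; rewrite ab ffunE => /eqP.
  by rewrite addn_eq0 => /andP[_ /eqP].
by rewrite (eps_sigma i b0) mul0r.
Qed.

Lemma sideal_left m : left_ideal (sideal m).
Proof.
split; [exact: sideal0|exact: sidealD|move=> a b hb].
have [_ coE _] := coP; have [s [_ _ ->]] := coE a.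
rewrite mulr_suml; apply: (big_ind (sideal m)); [exact: sideal0|exact: sidealD|].
move=> alpha _; rewrite -mulrA; apply: sideal_mull; rewrite smon_word.
elim: (mono_word alpha) => [|i w IH]; first by rewrite /word big_nil mul1r.
by rewrite word_cons -mulrA; apply: sideal_mulx.
Qed.

Lemma scoord_mulr_eq0 i alpha a : alpha i = 0 -> scoord alpha (a * x i) = 0.
Proof.
move=> ai; move: a; apply: (coords_ind coP) => [|a b ha hb|beta r].
- by rewrite mul0r scoord0.
- by rewrite mulrDl scoordD ha hb addr0.
- rewrite -mulrA scoord_mull; have [k _ ->] := scoord_smon_mulr i beta.
  by case: eqP ai => [->|_ _]; rewrite ?mulr0 // ffunE eqxx.
Qed.

(** As [mono_incr i] is injective, only the monomial [beta] of [a] contributes, so the factor does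
    not depend on [a]. *)
Lemma scoord_mulr i beta : exists2 k : K, k != 0 &
  forall a, scoord (mono_incr i beta) (a * x i) = k * scoord beta a.
Proof.
have [k k0 e] := scoord_smon_mulr i beta; exists k => //.
apply: (coords_ind coP) => [|a b ha hb|alpha r].
- by rewrite mul0r !scoord0 mulr0.
- by rewrite mulrDl !scoordD ha hb mulrDr.
- rewrite -mulrA !scoord_mull scoord_smon.
  have [l _ e'] := scoord_smon_mulr i alpha.
  case: (eqVneq beta alpha) => [<-|ba]; first by rewrite e eqxx mulrCA.
  by rewrite e' (inj_eq (@mono_incr_inj i)) (negPf ba) !mulr0.
Qed.

(** Only exponents of variables before [x i] are tested, and the shift of exponent [i] leaves them
    alone. The two directions give regularity of [x i] modulo the ideal and stability of the ideal,
    the hypotheses of the cone step. *)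
Lemma sideal_mulr (i : 'I_n) a : sideal i (a * x i) <-> sideal i a.
Proof.
split=> ha alpha alphaP.
  have [k k0 e] := scoord_mulr i alpha.
  apply/eqP; rewrite -(mulrI_eq0 _ (mulfI k0)) -e ha // => j ji.
  by rewrite ffunE alphaP // addn0; case: eqP ji => // ->; rewrite ltnn.
case: (posnP (alpha i)) => [/scoord_mulr_eq0 -> //|/mono_incrP[beta ab]].
have [k k0 e] := scoord_mulr i beta; rewrite ab e ha ?mulr0 // => j ji.
have := alphaP _ ji; rewrite ab ffunE => /eqP.
by rewrite addn_eq0 => /andP[_ /eqP].
Qed.

Lemma scoord_div i a : exists b, forall alpha, (0 < alpha i)%N ->
  scoord alpha (a - b * x i) = 0.
Proof.
move: a; apply: (coords_ind coP).
- by exists 0 => alpha _; rewrite mul0r subrr scoord0.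
- move=> a a' [b hb] [b' hb']; exists (b + b') => alpha ai.
  by rewrite mulrDl opprD addrACA scoordD hb // hb' // addr0.
move=> gamma r; case: (posnP (gamma i)) => [g0|/mono_incrP[beta ->]].
  exists 0 => alpha ai; rewrite mul0r subr0 scoord_mull scoord_smon.
  by case: eqP ai => [->|]; rewrite ?g0 ?mulr0.
have [k k0 e] := scoord_smon_mulr i beta.
(* [k^-1] cancels the scalar by which [smon x beta * x i] differs, in the coordinates [scoord], from
   a standard monomial. *)
exists (k^-1 *: (iota r * smon x beta)) => alpha _.
rewrite -scalerAl -mulrA scoordB scoordZ !scoord_mull e scoord_smon.
by rewrite mulrCA mulKf ?subrr.
Qed.

(** Right division by [x i] removes the monomials that contain [x i]; at the others a multiple of
    [x i] has coordinate zero, so the remainder agrees with [a] there. *)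
Lemma sidealS (i : 'I_n) a :
  sideal i.+1 a <-> exists l b, sideal i l /\ a = l + b * x i.
Proof.
split=> [ha|[l [b [hl ->]]] alpha alphaP].
  have [b hb] := scoord_div i a; exists (a - b * x i), b; rewrite subrK; split=> //.
  move=> alpha alphaP; case: (posnP (alpha i)) => [a0|]; last exact: hb.
  rewrite scoordB scoord_mulr_eq0 // subr0; apply: ha => j.
  by rewrite ltnS leq_eqVlt => /orP[/eqP/val_inj -> //|/alphaP].
rewrite scoordD hl ?add0r => [|j ji]; first by apply: scoord_mulr_eq0; apply: alphaP.
by apply: alphaP; apply: ltnW.
Qed.

Definition mono0 : mono := [ffun=> 0%N].

Lemma smon0 : smon x mono0 = 1.
Proof. by apply: mono_deg0; rewrite /mono_deg big1 // => i _; rewrite ffunE. Qed.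

Lemma sideal_top a : sideal n a <-> scoord mono0 a = 0.
Proof.
split=> [|ha alpha alphaP]; first by apply=> i _; rewrite ffunE.
suff -> : alpha = mono0 by [].
by apply/ffunP => i; rewrite alphaP ?ffunE.
Qed.

Lemma scoord_augmentation : exists epsA : {lrmorphism A -> K^o},
  (forall a, epsA a = scoord mono0 a) /\ augmentation (skew_grading iota x gR) epsA.
Proof.
pose f : A -> K^o := scoord mono0.
have f1 : f 1 = 1 by rewrite /f -smon0 scoord_smon eqxx.
have fl : linear f by move=> k a b; rewrite /f scoordD scoordZ.
have fM : monoid_morphism f.
  split=> // a b; have [_ _ LM] := sideal_left n.
  (* [b - (f b)%:A] lies in the kernel of [f], which is the left ideal [sideal n]; multiplicativity
     follows. *)
  have /sideal_top : sideal n (a * (b - (f b)%:A)).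
    by apply/LM/sideal_top; rewrite scoordB scoordZ [scoord _ 1]f1 mulr1 subrr.
  rewrite mulrBr scoordB -scalerAr mulr1 scoordZ => /eqP.
  by rewrite subr_eq0 => /eqP; rewrite mulrC.
pose F : {lrmorphism A -> K^o} := HB.pack f (GRing.isLinear.Build K A K^o *:%R f fl)
  (GRing.isMonoidMorphism.Build A K^o f fM).
exists F; split=> // p a p0 /skew_gradingP; move: a; apply: int_skew_ind.
- exact: scoord0.
- by move=> a b; rewrite raddfD => /= -> ->; rewrite addr0.
- move=> t r alpha gr tp /=; rewrite /f scoord_mull scoord_smon.
  case: eqP => [a0|]; last by rewrite mulr0.
  rewrite (epsP _ gr) ?mul0r //; move: p0; rewrite -tp -a0 /mono_deg.
  by rewrite big1 ?addn0 // => i _; rewrite ffunE.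
Qed.

End Augmentation.

(** * Standard monomials as a right basis *)

Section RightBasis.

Definition low_deg d (a : A) := forall alpha, (d <= mono_deg alpha)%N -> co alpha a = 0.

(** The coordinate of a word at a monomial of larger degree is homogeneous of negative degree, hence
    zero. *)
Lemma word_span_low_deg d a : word_span (fun _ w => (size w < d)%N) a -> low_deg d a.
Proof.
move: a; apply: word_span_ind.
- by move=> alpha _; apply: (coords0 coP).
- by move=> a b ha hb alpha h; rewrite (coordsD coP) ha // hb // addr0.
move=> r w wd alpha da; rewrite co_mull.
have := int_skew_word w alpha.
have [k ->] : exists k, (size w)%:Z - (mono_deg alpha)%:Z = Negz k.
  exists (mono_deg alpha - size w).-1.
  rewrite NegzE prednK ?subn_gt0 ?(leq_trans wd) //.
  by rewrite -subzn ?opprB // (leq_trans (ltnW wd)).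
by move=> /= ->; rewrite mulr0.
Qed.

Definition sigma_word w r : R := foldr (fun i => sigma i) r w.

Lemma word_mulr w r : word_span (fun _ u => (size u < size w)%N)
  (word w * iota r - iota (sigma_word w r) * word w).
Proof.
elim: w => [|i w IH].
  by rewrite /word big_nil mulr1 mul1r subrr; apply: word_span0.
rewrite word_cons -mulrA -[word w * _](subrK (iota (sigma_word w r) * word w)) mulrDr.
rewrite -addrA; apply: word_spanD.
  by apply: word_span_mulx IH => t u hu; split=> //=; rewrite ltnS // ltnW.
rewrite mulrA commA mulrDl mulrA addrAC subrr add0r.
exact: word_span1.
Qed.

Lemma sigma_word_bij w : bijective (sigma_word w).
Proof.
elim: w => [|i w IH]; first by exists id.
exact: (bij_comp (sigma_bij i) IH).
Qed.

Lemma sigma_word0 w : sigma_word w 0 = 0.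
Proof. by elim: w => //= i w ->; rewrite rmorph0. Qed.

(** By induction on degree: with [g] the inverse of [sigma_word], [smon x alpha * iota (g r)] has
    leading term [iota r * smon x alpha], and the difference involves monomials of smaller degree
    only. *)
Lemma right_span (G : A -> Prop) : G 0 -> (forall a b, G a -> G b -> G (a + b)) ->
  (forall alpha r, G (smon x alpha * iota r)) -> forall a, G a.
Proof.
move=> G0 GD G1; apply: (coords_ind coP) => // alpha r.
have [m] := ubnP (mono_deg alpha); elim: m alpha r => // m IH alpha r /ltnSE am.
have [g _ gK] := sigma_word_bij (mono_word alpha).
have := word_span_low_deg (word_mulr (mono_word alpha) (- g r)).
rewrite raddfN /= mulrN -smon_word size_mono_word.
have -> : sigma_word (mono_word alpha) (- g r) = - r.
  by rewrite -[r in RHS]gK; elim: (mono_word alpha) => //= i w ->; rewrite rmorphN.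
rewrite raddfN /= mulNr opprK => low_b.
rewrite -[iota r * _](addrK (- (smon x alpha * iota (g r)))) opprK.
apply: (GD) => //; rewrite addrC.
have [_ coE _] := coP; have [s [_ _ ->]] := coE (- (smon x alpha * iota (g r)) +
  iota r * smon x alpha).
apply: (big_ind G) => // beta _; case: (leqP (mono_deg alpha) (mono_deg beta)) => h.
  by rewrite low_b // rmorph0 mul0r.
by apply: IH; apply: leq_trans am.
Qed.

Lemma right_free (s : seq mono) (d : mono -> R) : uniq s ->
  \sum_(alpha <- s) smon x alpha * iota (d alpha) = 0 ->
  forall alpha, alpha \in s -> d alpha = 0.
Proof.
move=> us d0.
(* Descending induction on degree: [m] bounds how far [alpha] lies below the largest degree in [s],
   and for [m = 0] no [alpha] qualifies. *)
suff key m : forall alpha, alpha \in s ->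
    (\max_(beta <- s) mono_deg beta < m + mono_deg alpha)%N -> d alpha = 0.
  move=> alpha as_; apply: (key (\max_(beta <- s) mono_deg beta).+1) as_ _.
  by rewrite addSn ltnS leq_addr.
elim: m => [|m IH] alpha as_ lt.
  by move: lt; rewrite add0n ltnNge leq_bigmax_seq.
have [g sK _] := sigma_word_bij (mono_word alpha).
rewrite -[d alpha]sK -[RHS]sK sigma_word0; congr g.
(* In the coordinate of the relation at [alpha], terms of larger degree vanish by induction, the
   other monomials of degree at most that of [alpha] do not reach it, and [alpha] contributes the
   image of [d alpha] under [sigma_word]. *)
rewrite -(coords0 coP alpha) -d0 (coords_sum coP) (bigD1_seq alpha) //= big1_seq ?addr0.
  rewrite [X in co _ X](_ : _ = (smon x alpha * iota (d alpha) -
    iota (sigma_word (mono_word alpha) (d alpha)) * smon x alpha) +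
    iota (sigma_word (mono_word alpha) (d alpha)) * smon x alpha); last by rewrite subrK.
  rewrite (coordsD coP) co_mull co_smon eqxx mulr1 smon_word.
  by rewrite (word_span_low_deg (word_mulr _ _)) ?add0r // size_mono_word.
move=> beta /andP[ba bs]; case: (ltnP (mono_deg alpha) (mono_deg beta)) => h.
  rewrite IH ?rmorph0 ?mulr0 ?(coords0 coP) //.
  by apply: leq_trans lt _; rewrite addSn -addnS leq_add2l.
rewrite -[smon x beta * _](subrK
  (iota (sigma_word (mono_word beta) (d beta)) * smon x beta)).
rewrite (coordsD coP) co_mull co_smon eq_sym (negPf ba) mulr0 addr0 smon_word.
by apply: (word_span_low_deg (word_mulr _ _)); rewrite size_mono_word.
Qed.

End RightBasis.

(** * Assembly of the resolution of [K] *)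

Section Koszulness.

Variable eps : {lrmorphism R -> K^o}.
Hypothesis epsP : augmentation gR eps.

Local Notation gA := (skew_grading iota x gR).

Lemma skew_grading_iota p r : gR p r -> gA p (iota r).
Proof.
move=> gr; apply/skew_gradingP; rewrite -[iota r]mulr1 -smon0 -[p%:Z]addr0.
apply: int_skew_mull => //; have := int_skew_smon mono0.
by rewrite /mono_deg big1 // => i _; rewrite ffunE.
Qed.

(** [sideal eps 0] tests all monomials, so it is the common kernel of the [scoord]; the standard
    monomials therefore stay independent over [K] modulo it. *)
Lemma sideal0_resolution : (exists P gP d eta,
    @linear_free_resolution K R gR eps P gP d eta) ->
  has_linear_resolution gA (sideal eps 0).
Proof.
apply: (induced_resolution gR_alg skew_graded_algebra skew_grading_iota
  (m := smon x) right_span right_free (sideal_left epsP 0)).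
  move=> r alpha _; rewrite scoordB scoordZ -[iota r]mulr1 scoord_mull.
  exact: subrr.
move=> s k us Lk alpha sa.
have : scoord eps alpha (\sum_(i <- s) k i *: smon x i) = 0 by apply: Lk.
rewrite (big_morph _ (scoordD eps alpha) (scoord0 eps alpha)).
rewrite (bigD1_seq alpha) //= big1 ?addr0 => [|beta ba].
  by rewrite scoordZ scoord_smon eqxx mulr1.
by rewrite scoordZ scoord_smon eq_sym (negPf ba) mulr0.
Qed.

Lemma sideal_resolution m : (m <= n)%N ->
  has_linear_resolution gA (sideal eps 0) -> has_linear_resolution gA (sideal eps m).
Proof.
move=> + res0; elim: m => // m IH mn; have [P [gP [d [pi resP]]]] := IH (ltnW mn).
pose i := Ordinal mn.
apply: (has_linear_resolution_cone skew_graded_algebra (sideal_left epsP m)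
  (x1 i) _ _ resP).
- by move=> a; rewrite (sideal_mulr epsP i).
- by move=> a; rewrite (sideal_mulr epsP i).
- exact: (sidealS epsP i).
Qed.

End Koszulness.

Lemma skew_PBW_koszul : koszul gR -> koszul (skew_grading iota x gR).
Proof.
case=> _ _ lfR [eps [epsP resR]].
split; [exact: skew_graded_algebra|exact: skew_connected|exact: skew_locally_finite|].
have [epsA [epsAE epsAP]] := scoord_augmentation epsP.
exists epsA; split=> //.
have [P [gP [d [pi [gens gd [piZ pi_gr [v0 [_ v01]]] ex0 exS]]]]] :=
  sideal_resolution epsP (leqnn n) (sideal0_resolution epsP resR).
(* [pi] resolves [A] modulo [sideal n], the kernel of [epsA], so composing with [epsA] gives an
   augmentation onto [K]. *)
pose f (v : P 0) : K := epsA (pi v).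
have fB : {morph f : u v / u - v} by move=> u v; rewrite /f !raddfB.
pose eta : {additive P 0 -> K} := HB.pack f (GRing.isAdditive.Build (P 0) K f fB).
have etaE v : eta v = epsA (pi v) by [].
exists P, gP, d, eta; split=> //.
- split.
  + by move=> b v; rewrite !etaE piZ rmorphM.
  + move=> q v q0 /pi_gr; rewrite etaE; case: q q0 => [p|p] /= p0.
      by apply: epsAP; rewrite lt0n; apply: contraNneq p0 => ->.
    by move=> ->; rewrite raddf0.
  + move=> k; exists (k%:A *: v0); rewrite etaE piZ -scalerAl mul1r linearZ /=.
    suff -> : epsA (pi v0) = 1 by apply: mulr1.
    move/sideal_top: v01; rewrite -epsAE rmorphB rmorph1 => /eqP.
    by rewrite subr_eq0 => /eqP.
- move=> v; rewrite etaE epsAE; split.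
    by move=> e; apply/ex0/sideal_top.
  by move=> /ex0/sideal_top.
Qed.

End SkewPBWTheory.

Theorem theorem5p5 (K : fieldType) (R A : algType K) (gR : nat -> R -> Prop)
    (iota : {lrmorphism R -> A}) (n : nat) (x : 'I_n -> A)
    (R_finitely_presented : finitely_presented gR)
    (R_koszul : koszul gR)
    (A_graded_skew_PBW : graded_skew_PBW iota x gR) :
  koszul (skew_grading iota x gR).
Proof.
have [gR_alg gR_conn _ _] := R_koszul.
have [_ [_ basisA _ _] [sigma [delta [c [[[_ _ comm _] [bij inv]] x1 gr rel]]]]] :=
  A_graded_skew_PBW.
have [|co coP] := left_basis_coord _ basisA.
  by move=> r t a; rewrite GRing.rmorphB GRing.mulrBl.
exact: (skew_PBW_koszul gR_alg gR_conn comm bij inv x1 gr rel coP).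
Qed.
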